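(* Let $M$ be an Orlicz function which satisfies condition $\Delta_{2+}$ and such that $M''$ is a continuous function with $M''(0)=0$ and $M''(t)>0$ for all $t>0$. Let $f,g\in L_M$ and let $N(\alpha)=\|f+\alpha g\|_M$ for $\alpha\in\mathbb{R}$. Then: (a) If $f,g$ have disjoint supports and $g$ is bounded, then $N'(0)=0$ and $N''(\alpha)\to0$ as $\alpha\to0$ along a subset of $[0,1]$ of full measure. (b) If $N'(0)=0$ and $N''(\alpha)\to0$ as $\alpha\to0$ along a subset of $[0,1]$ of full measure, then $f,g$ have disjoint supports.
   Context: An Orlicz function is a convex function $M:[0,\infty)\to[0,\infty)$ with $M(0)=0$, $M(1)=1$, $\lim_{u\to0}M(u)/u=0$ and $\lim_{u\to\infty}M(u)/u=\infty$. The Orlicz space $L_M$ is the space of (equivalence classes of) measurable scalar-valued (real or complex) functions $f$ on $[0,1]$ with Lebesgue measure $\mu$ such that $\|f\|_M<\infty$, where $\|f\|_M=\inf\{\lambda>0:\int M(|f|/\lambda)\,d\mu\le 1\}$ (Luxemburg norm). Supports are disjoint if their intersection has measure zero. $M$ satisfies the $\Delta_2$ condition if there are $k>0$, $u_0\ge0$ with $M(2u)\le kM(u)$ for all $u\ge u_0$. $M$ satisfies condition $\Delta_{2+}$ if $M$ is twice differentiable, satisfies the $\Delta_2$ condition, and there are constants $\beta>0$ and $u_0\ge 0$ such that $\frac{uM''(u)}{M'(u)}<\beta$ for all $u\ge u_0$. Derivatives of $M$ at $0$ are one-sided. $N$ is convex in $\alpha$, so $N''(\alpha)$ exists for almost every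 $\alpha$. ''$N''(\alpha)\to 0$ as $\alpha\to0$ along a subset of $[0,1]$ of full measure'' means that there is a set $E\subset[0,1]$ of measure $1$ such that $N''(\alpha)$ exists for all $\alpha\in E$ and $N''(\alpha)\to0$ as $\alpha\to0$, $\alpha\in E$.
   Formalization: Part (a) is proved under the added assumption that f is not almost everywhere zero; without it (a) fails, e.g. for f = 0, g = 1, where N(α) = |α| is not differentiable at 0. *)

(* Defs.v *)
From HB Require Import structures.
From mathcomp Require Import all_boot all_order all_algebra.
From mathcomp Require Import complex.
From mathcomp Require Import all_classical all_reals all_analysis.

Set Implicit Arguments.
Unset Strict Implicit.
Unset Printing Implicit Defensive.

Import Order.TTheory GRing.Theory Num.Theory.
Import numFieldNormedType.Exports.

Local Open Scope ring_scope.
Local Open Scope classical_set_scope.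

Variant scalars := RealScalars | ComplexScalars.

(* [Rcomplex R] is [R[i]] regarded as a vector space over [R], with its modulus
   taking values in [R]. *)
Definition scalar_space (R : realType) (K : scalars) : lmodType R :=
  match K with
  | RealScalars => R^o
  | ComplexScalars => Rcomplex R
  end.

Definition modulus (R : realType) (K : scalars) : scalar_space R K -> R :=
  match K as k return scalar_space R k -> R with
  | RealScalars => fun x : R => `|x|
  | ComplexScalars => fun z : Rcomplex R => `|z|
  end.

Definition measurable_scalar (R : realType) (K : scalars) :
    (R -> scalar_space R K) -> Prop :=
  match K as k return (R -> scalar_space R k) -> Prop with
  | RealScalars => fun f : R -> R => measurable_fun (`[0, 1] : set R) f
  | ComplexScalars => fun f : R -> Rcomplex R =>
      measurable_fun (`[0, 1] : set R) (fun x => complex.Re (f x)) /\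
      measurable_fun (`[0, 1] : set R) (fun x => complex.Im (f x))
  end.

Section OrliczFunction.
Context {R : realType}.
Implicit Type M : R -> R.

(* Differentiation of functions on [0, +oo[: a function [M : R -> R] stands for
   its restriction to [0, +oo[, so the derivative at 0 is the right one. *)
Definition ray_quotient M (u h : R) : R := h^-1 * (M (u + h) - M u).

Definition ray_steps (u : R) : set_system R :=
  within [set h : R | 0 <= u + h] 0^'.

Definition ray_derivable M (u : R) : Prop :=
  cvg (ray_quotient M u h @[h --> ray_steps u]).

Definition ray_derive M (u : R) : R :=
  lim (ray_quotient M u h @[h --> ray_steps u]).

Definition orlicz_function M : Prop :=
  [/\ forall u : R, 0 <= u -> 0 <= M u,
      convex_function (`[0, +oo[%classic : set R) M,
      M 0 = 0 /\ M 1 = 1,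
      M u / u @[u --> 0^'+] --> (0 : R) &
      M u / u @[u --> +oo] --> +oo].

Definition Delta2 M : Prop :=
  exists k u0 : R, [/\ 0 < k, 0 <= u0 &
    forall u : R, u0 <= u -> M (2 * u) <= k * M u].

Definition Delta2plus M : Prop :=
  [/\ forall u : R, 0 <= u ->
        ray_derivable M u /\ ray_derivable (ray_derive M) u,
      Delta2 M &
      exists beta u0 : R, [/\ 0 < beta, 0 <= u0 &
        forall u : R, u0 <= u ->
          u * ray_derive (ray_derive M) u / ray_derive M u < beta]].

End OrliczFunction.

(* Functions on [0, 1] are total functions on [R] of which only the values on
   [0, 1] matter. *)
Section OrliczSpace.
Context {R : realType} {K : scalars}.
Implicit Types (M : R -> R) (f g : R -> scalar_space R K).
Local Notation mu := (@lebesgue_measure R).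

Definition luxemburg_norm M f : \bar R :=
  ereal_inf [set l%:E | l in [set l : R | 0 < l /\
    (\int[mu]_(x in `[0%R, 1%R]) (M (modulus (f x) / l))%:E <= 1)%E]].

Definition in_orlicz_space M f : Prop :=
  measurable_scalar f /\ (luxemburg_norm M f < +oo)%E.

Definition support01 f : set R := [set x | `[0, 1] x /\ f x != 0].

Definition disjoint_supports f g : Prop :=
  mu (support01 f `&` support01 g) = 0%E.

Definition bounded01 f : Prop :=
  exists C : R, {ae mu, forall x : R, `[0, 1] x -> modulus (f x) <= C}.

Definition null01 f : Prop :=
  {ae mu, forall x : R, `[0, 1] x -> f x = 0}.

Definition norm_along_line M f g (alpha : R) : R :=
  fine (luxemburg_norm M (fun x => f x + alpha *: g x)).

End OrliczSpace.

Section SecondDerivative.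
Context {R : realType}.
Implicit Type N : R -> R.

Definition twice_derivable_at N (a : R) : Prop :=
  (\forall x \near a, derivable N x 1) /\ derivable (N^`()) a 1.

Definition second_derivative_vanishes_ae N : Prop :=
  exists E : set R, [/\ measurable E, E `<=` `[0, 1],
    (@lebesgue_measure R) E = 1%E,
    forall a : R, E a -> twice_derivable_at N a &
    N^`(2) a @[a --> within E 0^'] --> (0 : R)].

End SecondDerivative.

(* Main.v *)
Require Import Defs.
From mathcomp Require Import all_boot all_order all_algebra.
From mathcomp Require Import complex.
From mathcomp Require Import all_classical all_reals all_analysis.
From mathcomp Require Import measurable_realfun.
From mathcomp Require Import lra ring.
Set Implicit Arguments.
Unset Strict Implicit.
Unset Printing Implicit Defensive.
Import Order.TTheory GRing.Theory Num.Theory.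
Import numFieldNormedType.Exports.
Local Open Scope ring_scope.
Local Open Scope classical_set_scope.

(** Write [m t = M |t|]. Under the hypotheses [m] is an even [C^2] function on the
    whole line with [m'' 0 = 0] and [m'' > 0] elsewhere, so all the analysis is
    done with [m] and two-sided derivatives. For [w >= 0] on [[0, 1]] put
    [J_w t = int m (t w)]. The [Delta2] condition makes [J_w] finite and
    continuous; if [w] is not a.e. zero, the Luxemburg norm of [w] is the only
    [l > 0] with [J_w (1 / l) = 1]. In particular [N a > 0] is determined by
    [int m (|f + a g| / N a) = 1] as soon as [f + a g] is not a.e. zero.

    Disjoint supports imply smoothness. The equation for [N] splits as
    [A (1 / N a) + B (a / N a) = 1] with [A = J_|f|] and [B = J_|g|]. The growth
    condition on [u M'' u / M' u] together with [Delta2] allows differentiating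
    [A] twice under the integral sign on the open half-line, and boundedness of
    [g] allows the same for [B] on the whole line
    ([modular_smooth_pos], [modular_smooth_bounded]). The implicit function
    theorem, done by hand in one variable, gives
    [N' a = B' (a / N a) N a / (A' (1 / N a) + a B' (a / N a))], whence [N] is
    [C^2] on the whole line, and [N' 0 = N'' 0 = 0] because
    [B' 0 = B'' 0 = 0]. The set of full measure is then the whole interval [[0, 1]].

    Overlapping supports forbid [N'' -> 0]. No formula for [N''] is used. On a
    set [S] of positive measure both moduli lie between two positive constants,
    and there [m o modulus] is uniformly strongly convex. For small [a] and [h] let
    [u], [v] be the functions [f + (a + h) g], [f + (a - h) g] divided by their
    norms. With [b] the average of the two norms, [(f + a g) / b] is a convex
    combination of [u] and [v]; since [N] is convex with [N' 0 = 0], the norms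
    differ by at most a small multiple of [h], so that [|u - v| >= const h] on [S]
    ([chord_gap]). Strong convexity yields
    [J (1 / b) <= 1 - const h^2] ([modular_midpoint_gap]), while [J (1 / N a) = 1]
    for the same function; as [J] is Lipschitz by [Delta2], this means
    [N (a + h) + N (a - h) - 2 N a >= const h^2] uniformly for [a] near [0]
    ([second_difference_ge]). Hence [N'' a >= const > 0] wherever [N''] exists near
    [0]. *)

(** * The even extension of an Orlicz function *)

Section EvenExtension.
Context {R : realType}.
Implicit Types F G : R -> R.

(** Away from the origin the restriction to steps staying on the ray is
    eventually void, so the derivative on the ray is a two-sided derivative.
    *)
Lemma ray_cvg_pos F (u : R) : 0 < u -> ray_derivable F u ->
  h^-1 * (F (u + h) - F u) @[h --> 0^'] --> ray_derive F u.
Proof.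
move=> u0 cF; apply: cvg_trans cF => A /= [e /= e0 eA].
exists (Num.min e u); first by rewrite /= lt_min e0.
move=> h /=; rewrite sub0r normrN lt_min => /andP[he hu] h0.
apply: eA => //=; first by rewrite sub0r normrN.
by move: hu; rewrite ltr_norml => /andP[? _]; lra.
Qed.

Lemma is_derive_ray_pos F G (u : R) : 0 < u -> ray_derivable F u ->
  (forall t, 0 < t -> G t = F t) -> is_derive u 1 G (ray_derive F u).
Proof.
move=> u0 /(ray_cvg_pos u0) cF GF.
have isF : is_derive u (1 : R) F (ray_derive F u).
  have cF' : (fun h : R => h^-1 *: ((F \o shift u) (h *: (1 : R)) - F u)) @ 0^' -->
      ray_derive F u.
    apply: cvg_trans cF; apply: near_eq_cvg; near=> h.
    by rewrite /= [_%:A]mulr1 (addrC h).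
  by apply: DeriveDef; [apply/cvg_ex; exists (ray_derive F u) | apply: cvg_lim].
apply: near_eq_is_derive isF; near=> t; rewrite GF//.
by near: t; exact: lt_nbhsr.
Unshelve. all: by end_near. Qed.

Lemma is_derive_ray_neg F G (u s : R) : u < 0 -> ray_derivable F (- u) ->
  (forall t, t < 0 -> G t = s * F (- t)) ->
  is_derive u 1 G (- s * ray_derive F (- u)).
Proof.
move=> u0 cF GF.
have u0' : 0 < - u by lra.
have isF := is_derive_ray_pos u0' cF (fun t _ => erefl).
have isFN : is_derive u (1 : R) (fun t => F (- t)) (ray_derive F (- u) * (- 1)).
  exact: (@is_derive1_comp _ F -%R).
have isF' : is_derive u (1 : R) (s \*: (fun t => F (- t))) (- s * ray_derive F (- u)).
  by apply: is_derive_eq; rewrite /GRing.scale /=; ring.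
apply: near_eq_is_derive isF'; near=> t; rewrite GF//.
by near: t; exact: lt_nbhsl.
Unshelve. all: by end_near. Qed.

(** At the origin the extension [G] may be even or odd; only [|G t| = |F |t||]
    matters, because the derivative on the ray vanishes. *)
Lemma is_derive_ray_0 F G : ray_derivable F 0 -> ray_derive F 0 = 0 ->
  F 0 = 0 -> (forall t, `|G t| = `|F `|t| |) -> is_derive (0 : R) 1 G 0.
Proof.
move=> cF dF0 F0 GF.
have G0 : G 0 = 0 by apply/eqP; rewrite -normr_eq0 GF normr0 F0 normr0.
have cG : (fun h : R => h^-1 *: ((G \o shift 0) (h *: (1 : R)) - G 0)) @ 0^' -->
    (0 : R).
  have : ray_quotient F 0 h @[h --> ray_steps 0] --> ray_derive F 0 by exact: cF.
  rewrite dF0; move=> /cvgr0Pnorm_lt cF0; apply/cvgr0Pnorm_lt => e e0.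
  have [d /= d0 dF] := cF0 e e0.
  exists d => //= h; rewrite /= sub0r normrN => hd h0.
  have := dF `|h|; rewrite /= sub0r normrN normr_id normr_eq0 !add0r => /(_ hd h0).
  move=> /(_ (normr_ge0 _)); apply: le_lt_trans.
  rewrite /ray_quotient add0r F0 subr0 G0 subr0 [_%:A]mulr1 addr0 /GRing.scale /=.
  by rewrite !normrM !normfV normr_id GF.
by apply: DeriveDef; [apply/cvg_ex; exists 0 | apply: cvg_lim].
Qed.

Lemma ray_derive0_eq0 F : F 0 = 0 -> ray_derivable F 0 ->
  F u / u @[u --> 0^'+] --> (0 : R) -> ray_derive F 0 = 0.
Proof.
move=> F0 cF Fu.
have cF' : F u / u @[u --> 0^'+] --> ray_derive F 0.
  apply: cvg_trans cF => A /= [e /= e0 eA].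
  exists e => //= h; rewrite /ball_ /= sub0r normrN => he h0.
  have := eA h; rewrite /= sub0r normrN add0r /ray_quotient add0r F0 subr0 mulrC.
  by apply => //; [rewrite gt_eqF | exact: ltW].
exact: (cvg_unique _ cF' Fu).
Qed.

Lemma continuous_ray_norm F : {within `[0, +oo[, continuous F} ->
  continuous (fun t : R => F `|t|).
Proof.
move=> cF t; have t0 : `[0, +oo[%classic `|t| by rewrite /= in_itv /= normr_ge0.
have cFt : F x @[x --> within `[0, +oo[ (nbhs `|t|)] --> F `|t|.
  by rewrite (nbhs_subspace_in t0); exact: cF.
apply: (@cvg_comp _ _ _ (fun t : R => `|t|) F _ _ _ _ cFt) => A.
rewrite /within /= => nA.
have := @norm_continuous _ R t _ nA.
rewrite /= !nbhs_filterE => nA'.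
near=> s.
have : `[0, +oo[%classic `|s| by rewrite /= in_itv /= normr_ge0.
by near: s.
Unshelve. all: by end_near. Qed.

End EvenExtension.

(** An even [C^2] function [m] on the line, with derivatives [m1] and [m2],
    whose second derivative vanishes at the origin only. These are the
    properties of [M |t|] from which everything else is deduced. *)
Record even_C2_orlicz (R : realType) (m m1 m2 : R -> R) : Prop := EvenC2Orlicz {
  orl_even : forall t, m (- t) = m t;
  orl_0 : m 0 = 0;
  orl_d1 : forall t : R, is_derive t 1 m (m1 t);
  orl_d2 : forall t : R, is_derive t 1 m1 (m2 t);
  orl_cont : continuous m2;
  orl_m1_0 : m1 0 = 0;
  orl_m2_0 : m2 0 = 0;
  orl_m2_gt0 : forall t, t != 0 -> 0 < m2 t }.

Section Construction.
Context {R : realType} (M : R -> R).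
Hypothesis hM : orlicz_function M.
Hypothesis hder : forall u : R, 0 <= u ->
        ray_derivable M u /\ ray_derivable (ray_derive M) u.
Hypothesis hcont : {within `[0, +oo[, continuous (ray_derive (ray_derive M))}.
Hypothesis hM0 : ray_derive (ray_derive M) 0 = 0.
Hypothesis hMpos : forall t : R, 0 < t -> 0 < ray_derive (ray_derive M) t.

(** The even extension [t -> M |t|] and its first two derivatives. *)
Definition even_ext (t : R) : R := M `|t|.
Definition even_ext1 (t : R) : R := Num.sg t * ray_derive M `|t|.
Definition even_ext2 (t : R) : R := ray_derive (ray_derive M) `|t|.

Lemma even_C2_orlicz_ext : even_C2_orlicz even_ext even_ext1 even_ext2.
Proof.
have [M0 _ [M00 M1] Mu0 _] := hM.
have dM0 : ray_derive M 0 = 0.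
  by apply: ray_derive0_eq0 => //; have [] := hder (lexx 0).
split.
- by move=> t; rewrite /even_ext normrN.
- by rewrite /even_ext normr0.
- move=> t; rewrite /even_ext1; have [t0|t0|->] := ltgtP t 0.
  + rewrite ltr0_sg// ltr0_norm//.
    apply: is_derive_ray_neg => //; first by have [] := hder (u:=-t) ltac:(lra).
    by move=> s s0; rewrite /even_ext mul1r ltr0_norm.
  + rewrite gtr0_sg// gtr0_norm// mul1r.
    apply: is_derive_ray_pos => //; first by have [] := hder (ltW t0).
    by move=> s s0; rewrite /even_ext gtr0_norm.
  + rewrite sgr0 mul0r; apply: (@is_derive_ray_0 _ M) => //.
    by have [] := hder (lexx 0).
- move=> t; rewrite /even_ext2; have [t0|t0|->] := ltgtP t 0.
  + rewrite ltr0_norm// -[X in is_derive _ _ _ X]mul1r -[X in X * _]opprK.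
    apply: is_derive_ray_neg => //; first by have [] := hder (u:=-t) ltac:(lra).
    by move=> s s0; rewrite /even_ext1 ltr0_sg ?ltr0_norm.
  + rewrite gtr0_norm//.
    apply: is_derive_ray_pos => //; first by have [] := hder (ltW t0).
    by move=> s s0; rewrite /even_ext1 gtr0_norm// gtr0_sg// mul1r.
  + rewrite normr0 hM0; apply: (@is_derive_ray_0 _ (ray_derive M)) => //.
    by have [] := hder (lexx 0).
    move=> s; rewrite /even_ext1 normrM normr_sg.
    by have [->|s0] := eqVneq s 0; rewrite ?normr0 ?dM0 ?normr0 ?mulr0// mul1r.
- exact: continuous_ray_norm.
- by rewrite /even_ext1 sgr0 mul0r.
- by rewrite /even_ext2 normr0.
- by move=> t t0; apply: hMpos; rewrite normr_gt0.
Qed.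

End Construction.

(** * Convexity inequalities *)

Section Calculus.
Context {R : realType}.
Implicit Types f : R -> R.

Lemma is_derive1_continuous f (x l : R) : is_derive x 1 f l -> {for x, continuous f}.
Proof. by move=> [df _]; exact/differentiable_continuous/derivable1_diffP. Qed.

Lemma MVT_le f (f1 : R -> R) (x y : R) : x <= y ->
  (forall t : R, x <= t <= y -> is_derive t 1 f (f1 t)) ->
  exists2 t, x <= t <= y & f y - f x = f1 t * (y - x).
Proof.
move=> xy df.
have [||t] := @MVT_segment _ f f1 _ _ xy.
- by move=> t; rewrite in_itv /= => /andP[xt ty]; apply: df; rewrite !ltW.
- apply: continuous_in_subspaceT => t /set_mem; rewrite /= in_itv /= => txy.
  exact: is_derive1_continuous (df t txy).
- by rewrite in_itv /= => ? ?; exists t.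
Qed.

Lemma nondecreasing_of_derive f (f1 : R -> R) (a b : R) :
  (forall t : R, a <= t <= b -> is_derive t 1 f (f1 t)) ->
  (forall t, a <= t <= b -> 0 <= f1 t) ->
  forall x y, a <= x -> x <= y -> y <= b -> f x <= f y.
Proof.
move=> df f10 x y ax xy yb.
have [t txy|t /andP[xt ty] e] := @MVT_le f f1 x y xy.
  by case/andP: txy => ? ?; apply: df; rewrite (le_trans _ yb) ?(le_trans ax).
by rewrite -subr_ge0 e mulr_ge0 ?subr_ge0// f10// (le_trans ax xt) (le_trans ty yb).
Qed.

(** The graph of a function with nondecreasing derivative lies above its
    tangents. *)
Lemma tangent_le f (f1 : R -> R) (a b : R) :
  (forall t : R, a <= t <= b -> is_derive t 1 f (f1 t)) ->
  (forall s t, a <= s -> s <= t -> t <= b -> f1 s <= f1 t) ->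
  forall x y, a <= x <= b -> a <= y <= b -> f x + f1 x * (y - x) <= f y.
Proof.
move=> df f1nd x y /andP[ax xb] /andP[ay yb].
have [xy|/ltW yx] := leP x y.
- have [t txy|t /andP[xt ty] e] := @MVT_le f f1 x y xy.
    by case/andP: txy => ? ?; apply: df; rewrite (le_trans _ yb) ?(le_trans ax).
  have := f1nd x t ax xt (le_trans ty yb); nra.
- have [t txy|t /andP[xt ty] e] := @MVT_le f f1 y x yx.
    by case/andP: txy => ? ?; apply: df; rewrite (le_trans _ xb) ?(le_trans ay).
  have := f1nd t x (le_trans ay xt) ty xb; nra.
Qed.

End Calculus.

Section Inequalities.
Context {R : realType} {m m1 m2 : R -> R} (hm : even_C2_orlicz m m1 m2).

Lemma orl_m2_ge0 t : 0 <= m2 t.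
Proof.
by have [->|t0] := eqVneq t 0; [rewrite (orl_m2_0 hm)|exact/ltW/(orl_m2_gt0 hm)].
Qed.

Lemma orl_m1_le x y : x <= y -> m1 x <= m1 y.
Proof.
move=> xy; apply: (@nondecreasing_of_derive _ m1 m2 x y) => // t _.
  exact: orl_d2 hm t.
exact: orl_m2_ge0.
Qed.

Lemma orl_m1_gt0 x : 0 < x -> 0 < m1 x.
Proof.
move=> x0.
have cm : {within `[0, x], continuous m1}.
  by apply: continuous_in_subspaceT => t _; exact: is_derive1_continuous (orl_d2 hm t).
have [t] := @MVT _ m1 m2 0 x x0 (fun t _ => orl_d2 hm t) cm.
rewrite in_itv /= (orl_m1_0 hm) !subr0 => /andP[t0 _] ->.
by rewrite mulr_gt0// (orl_m2_gt0 hm)// gt_eqF.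
Qed.

Lemma orl_m1_ge0 x : 0 <= x -> 0 <= m1 x.
Proof. by move=> x0; rewrite -(orl_m1_0 hm) orl_m1_le. Qed.

Lemma orl_m1_mul_ge0 x : 0 <= x * m1 x.
Proof.
have [x0|/ltW x0] := leP 0 x; first by rewrite mulr_ge0// orl_m1_ge0.
by rewrite mulr_le0// -(orl_m1_0 hm) orl_m1_le.
Qed.

Lemma orl_tangent x y : m x + m1 x * (y - x) <= m y.
Proof.
pose a := Num.min x y; pose b := Num.max x y.
apply: (@tangent_le _ m m1 a b).
- by move=> t _; exact: orl_d1 hm t.
- by move=> s t _ st _; exact: orl_m1_le.
- by rewrite ge_min lexx le_max lexx.
- by rewrite ge_min lexx orbT le_max lexx orbT.
Qed.

Lemma orl_ge0 x : 0 <= m x.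
Proof. by have := orl_tangent 0 x; rewrite (orl_0 hm) (orl_m1_0 hm) mul0r addr0. Qed.

Lemma orl_gt0 x : 0 < x -> 0 < m x.
Proof.
move=> x0; have := orl_tangent (x / 2) x; have := orl_ge0 (x / 2).
have : 0 < m1 (x / 2) by apply: orl_m1_gt0; lra.
nra.
Qed.

Lemma orl_le x y : 0 <= x -> x <= y -> m x <= m y.
Proof.
move=> x0 xy; have := orl_tangent x y; have := orl_m1_ge0 x0; nra.
Qed.

Lemma orl_convex th x y : 0 <= th <= 1 ->
  m (th * x + (1 - th) * y) <= th * m x + (1 - th) * m y.
Proof.
move=> /andP[t0 t1]; set z := th * x + (1 - th) * y.
have h1 : th * (m z + m1 z * (x - z)) <= th * m x.
  by rewrite ler_wpM2l// orl_tangent.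
have h2 : (1 - th) * (m z + m1 z * (y - z)) <= (1 - th) * m y.
  by rewrite ler_wpM2l ?subr_ge0// orl_tangent.
suff -> : m z = th * (m z + m1 z * (x - z)) + (1 - th) * (m z + m1 z * (y - z)).
  lra.
rewrite /z; ring.
Qed.

Lemma orl_m1_mul_le u : 0 <= u -> u * m1 u <= m (2 * u).
Proof.
move=> u0; have := orl_tangent u (2 * u); have := orl_ge0 u.
by rewrite [2 * u - u](_ : _ = u); [lra | ring].
Qed.

(** The source of the Lipschitz bound on the modular: the slope
    on [[s u, t u]] is at most the slope on [[t u, 2 t u]]. *)
Lemma orl_slope s t u : 0 <= s -> s <= t -> 0 <= u ->
  t * (m (t * u) - m (s * u)) <= (t - s) * m (2 * (t * u)).
Proof.
move=> s0 st u0.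
have h1 := orl_tangent (t * u) (s * u).
have h2 : t * u * m1 (t * u) <= m (2 * (t * u)) by rewrite orl_m1_mul_le// mulr_ge0//; lra.
have h3 : (t - s) * (t * u * m1 (t * u)) <= (t - s) * m (2 * (t * u)).
  by rewrite ler_wpM2l ?subr_ge0.
apply: le_trans h3.
rewrite [leRHS](_ : _ = t * ((t - s) * u * m1 (t * u))); last ring.
rewrite ler_wpM2l//; last lra.
lra.
Qed.

(** The quantity [s] need only lie below the convex combination of [p] and
    [q]: on a compact interval of positive reals [m t - c t^2] is still both
    convex and nondecreasing for a small [c > 0]. *)
Lemma orl_strong_convex (a b : R) : 0 < a -> a <= b -> exists2 c, 0 < c &
  forall p q s th, a <= p <= b -> a <= q <= b -> a <= s <= b -> 0 <= th <= 1 ->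
  s <= th * p + (1 - th) * q ->
  m s + c * (th * p ^+ 2 + (1 - th) * q ^+ 2 - s ^+ 2) <= th * m p + (1 - th) * m q.
Proof.
move=> a0 ab.
have b0 : 0 < b by lra.
have cm2 : {within `[a, b], continuous m2}.
  by apply: continuous_in_subspaceT => t _; exact: orl_cont hm t.
have [t0 t0ab t0min] := EVT_min ab cm2.
(* The first bound keeps [m t - c t^2] convex, the second one nondecreasing. *)
pose d := Num.min (m2 t0) (m1 a / b).
have d0 : 0 < d.
  rewrite lt_min (orl_m2_gt0 hm) ?divr_gt0 ?orl_m1_gt0//.
  by move: t0ab; rewrite in_itv /= => /andP[? _]; rewrite gt_eqF//; lra.
pose c := d / 2.
have c0 : 0 < c by rewrite divr_gt0.
pose H := fun t => m t - c * t ^+ 2.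
pose H1 := fun t => m1 t - d * t.
have dH (t : R) : is_derive t 1 H (H1 t).
  have dm := orl_d1 hm t.
  have : is_derive t (1 : R) (m \- c \*: (fun t => t ^+ 2)) (H1 t).
    by apply: is_derive_eq; rewrite /H1 /GRing.scale /= /c; field.
  by [].
have dH1 (t : R) : is_derive t 1 H1 (m2 t - d).
  have dm := orl_d2 hm t.
  have : is_derive t (1 : R) (m1 \- d \*: id) (m2 t - d).
    by apply: is_derive_eq; rewrite /GRing.scale /= mulr1.
  by [].
have H1nd s t : a <= s -> s <= t -> t <= b -> H1 s <= H1 t.
  apply: (@nondecreasing_of_derive _ H1 (fun t => m2 t - d) a b) => // u aub.
  rewrite subr_ge0 ge_min; apply/orP; left; apply: t0min; by rewrite in_itv.
have H1ge0 t : a <= t <= b -> 0 <= H1 t.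
  move=> /andP[aut tb]; rewrite /H1 subr_ge0.
  apply: (le_trans (y := m1 a)); last exact: orl_m1_le.
  apply: (le_trans (y := d * b)); first by rewrite ler_pM2l.
  by rewrite -ler_pdivlMr// ge_min lexx orbT.
have Hnd x y : a <= x -> x <= y -> y <= b -> H x <= H y.
  exact: (@nondecreasing_of_derive _ H H1 a b).
have Htan x y : a <= x <= b -> a <= y <= b -> H x + H1 x * (y - x) <= H y.
  exact: (@tangent_le _ H H1 a b).
exists c => // p q s th hp hq hs /andP[th0 th1]; set z := _ + _ => sz.
have hz : a <= z <= b.
  move: hp hq => /andP[? ?] /andP[? ?]; rewrite /z; apply/andP; split; nra.
have h1 : th * (H z + H1 z * (p - z)) <= th * H p.
  by rewrite ler_wpM2l// Htan.
have h2 : (1 - th) * (H z + H1 z * (q - z)) <= (1 - th) * H q.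
  by rewrite ler_wpM2l ?subr_ge0// Htan.
have h3 : H s <= H z.
  by move: hs hz => /andP[? ?] /andP[? ?]; exact: Hnd.
have h4 : H z = th * (H z + H1 z * (p - z)) + (1 - th) * (H z + H1 z * (q - z)).
  rewrite /z; ring.
have h5 : H s <= th * H p + (1 - th) * H q by lra.
move: h5; rewrite /H; lra.
Qed.

End Inequalities.

Section Growth.
Context {R : realType} (M : R -> R).
Local Notation m := (even_ext M).
Local Notation m1 := (even_ext1 M).
Local Notation m2 := (even_ext2 M).
Hypothesis hm : even_C2_orlicz m m1 m2.

(** [Delta2] for all arguments: the additive constant absorbs the arguments
    below the threshold. *)
Lemma Delta2_affine : Delta2 M ->
  exists k c, [/\ 0 < k, 0 <= c & forall u, 0 <= u -> m (2 * u) <= k * m u + c].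
Proof.
move=> [k [u0 [k0 u00 kM]]]; exists k, (m (2 * u0)); split => //.
  exact: (orl_ge0 hm).
move=> u u_ge0; have [u0u|/ltW uu0] := leP u0 u.
  have := kM u u0u; have := orl_ge0 hm (2 * u0).
  rewrite /even_ext ger0_norm; last lra.
  by rewrite !ger0_norm//; lra.
have := orl_le hm (x := 2 * u) (y := 2 * u0); have := orl_ge0 hm u; nra.
Qed.

(** The growth condition is used in this form: [u^2 M'' u] is controlled by [M
    (2 u)], up to a constant absorbing the arguments below the threshold. *)
Lemma Delta2plus_affine : Delta2plus M ->
  exists k c, [/\ 0 < k, 0 <= c & forall u, 0 <= u ->
    u ^+ 2 * m2 u <= k * m (2 * u) + c].
Proof.
move=> [_ _ [b [u0 [b0 u00 hb]]]].
have cf : {within `[0, u0], continuous (fun u => u ^+ 2 * m2 u)}.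
  apply: continuous_in_subspaceT => t _; apply: cvgM; last exact: orl_cont hm t.
  exact: exprn_continuous.
have [v v0 vmax] := EVT_max u00 cf.
exists b, (v ^+ 2 * m2 v); split => //.
  by rewrite mulr_ge0// ?sqr_ge0// (orl_m2_ge0 hm).
move=> u u_ge0; have [u0u|uu0] := ltP u0 u.
  have u_gt0 : 0 < u by lra.
  have := hb u (ltW u0u); have := orl_m1_gt0 hm u_gt0.
  have -> : ray_derive M u = m1 u by rewrite /even_ext1 gtr0_sg// gtr0_norm// mul1r.
  have -> : ray_derive (ray_derive M) u = m2 u by rewrite /even_ext2 gtr0_norm.
  move=> m1u; rewrite ltr_pdivrMr// => hu.
  have := orl_m1_mul_le hm u_ge0.
  have : 0 <= v ^+ 2 * m2 v by rewrite mulr_ge0// ?sqr_ge0// (orl_m2_ge0 hm).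
  nra.
have := vmax u; rewrite in_itv /= u_ge0 uu0 => /(_ isT).
have := orl_ge0 hm (2 * u); nra.
Qed.

End Growth.

(** * The modular *)

Local Notation unit_itv R := (`[0, 1]%classic : set (Real.sort R)).
Local Notation measurable_unit f := (@measurable_fun _ _ (measurableTypeR _) _ (unit_itv _) f).

(** The modular [t -> int_[0,1] m (t w)], as a function of the inverse [t] of
    the norm parameter. *)
Definition modular {R : realType} (m w : R -> R) (t : R) : R :=
  \int[@lebesgue_measure R]_(x in unit_itv R) m (t * w x).

(** Nonnegative measurable functions all of whose multiples have a finite
    modular. Only measurability on [[0, 1]] is required, for the sigma-algebra
    carrying Lebesgue measure. *)
Record orlicz_class {R : realType} (m w : R -> R) : Prop := OrliczClass {
  ocl_meas : measurable_unit w;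
  ocl_ge0 : forall x, 0 <= w x;
  ocl_int : forall t : R, (@lebesgue_measure R).-integrable (unit_itv R)
      (EFin \o (fun x => m (t * w x))) }.

Lemma measurable_unit_itv (R : realType) : @measurable _ (measurableTypeR R) (unit_itv R).
Proof. exact: measurable_itv. Qed.
Arguments measurable_unit_itv R : clear implicits.

Section UnitInterval.
Context {R : realType}.
Local Notation mu := (@lebesgue_measure R).
Local Notation I := (unit_itv R).

Lemma lebesgue_measure_unit_itv : mu I = 1%E.
Proof. by rewrite lebesgue_measure_itv /= lte01 sube0. Qed.

Lemma integrable_cst_unit (c : R) : mu.-integrable I (EFin \o cst c).
Proof.
apply/integrableP; split; first by apply/measurable_EFinP; exact: measurable_cst.
under eq_integral do rewrite /=.
by rewrite integral_cst//= [X in (_ * X)%E]lebesgue_measure_unit_itv mule1 ltry.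
Qed.

Lemma Rintegral_cst_unit (c : R) : \int[mu]_(x in I) c = c.
Proof.
have := Rintegral_cst mu (measurable_unit_itv R) c; rewrite /= => ->.
by rewrite [X in fine X]lebesgue_measure_unit_itv mulr1.
Qed.

Lemma integrable_dominated (f g : R -> R) : measurable_unit f ->
  mu.-integrable I (EFin \o g) -> (forall x, I x -> `|f x| <= g x) ->
  mu.-integrable I (EFin \o f).
Proof.
move=> mf ig fg; apply: (@le_integrable _ _ _ mu I (measurable_unit_itv R) (EFin \o f)
  (EFin \o g)) => //.
- exact/measurable_EFinP.
- by move=> x Ix; rewrite /= !lee_fin (le_trans (fg _ Ix))// ler_norm.
Qed.

Lemma integrable_lincomb (f g : R -> R) (a b : R) :
  mu.-integrable I (EFin \o f) -> mu.-integrable I (EFin \o g) ->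
  mu.-integrable I (EFin \o (fun x => a * f x + b * g x)).
Proof.
move=> fi gi; have m := measurable_unit_itv R.
have := integrableD m (integrableZl m a fi) (integrableZl m b gi).
by apply: eq_integrable => // x _; rewrite /= EFinD !EFinM.
Qed.

Lemma Rintegral_lincomb (f g : R -> R) (a b : R) :
  mu.-integrable I (EFin \o f) -> mu.-integrable I (EFin \o g) ->
  \int[mu]_(x in I) (a * f x + b * g x) =
  a * \int[mu]_(x in I) f x + b * \int[mu]_(x in I) g x.
Proof.
move=> fi gi; have m := measurable_unit_itv R.
rewrite RintegralD//; first by rewrite !RintegralZl.
- by have := integrableZl m a fi; apply: eq_integrable => // x _; rewrite /= EFinM.
- by have := integrableZl m b gi; apply: eq_integrable => // x _; rewrite /= EFinM.
Qed.

End UnitInterval.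

Section Modular.
Context {R : realType} {m m1 m2 : R -> R} (hm : even_C2_orlicz m m1 m2).
Context {k c : R}
  (hD2 : forall u, 0 <= u -> m (2 * u) <= k * m u + c).
Local Notation mu := (@lebesgue_measure R).
Local Notation I := (unit_itv R).
Implicit Types u v w : R -> R.

Lemma orl_measurable w t : measurable_unit w -> measurable_unit (fun x => m (t * w x)).
Proof.
move=> mw; apply: (measurableT_comp (f := m)).
  apply: continuous_measurable_fun => x; exact: is_derive1_continuous (orl_d1 hm x).
exact: measurable_funM.
Qed.

Lemma orl_norm x : m `|x| = m x.
Proof. by have [_|_] := ger0P x; rewrite ?(orl_even hm). Qed.

(** By [Delta2], one multiple with finite modular suffices. *)
Lemma orlicz_class_of w t : measurable_unit w -> (forall x, 0 <= w x) -> 0 < t ->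
  mu.-integrable I (EFin \o (fun x => m (t * w x))) -> orlicz_class m w.
Proof.
move=> mw w0 t0 it.
(* [Delta2] doubles the multiple; every real multiple is below some [2^n t]. *)
have step n : mu.-integrable I (EFin \o (fun x => m (2 ^+ n * t * w x))).
  elim: n => [|n IH]; first by
    move: it; apply: eq_integrable => // x _; rewrite /= expr0 mul1r.
  have := integrable_lincomb k 1 IH (integrable_cst_unit c).
  move/(integrable_dominated _); apply; first exact: orl_measurable.
  move=> x Ix; rewrite ger0_norm ?(orl_ge0 hm)// exprS -!mulrA /= mul1r.
  by rewrite hD2 // !mulr_ge0// ?exprn_ge0// ltW.
split => // s; pose n := Num.bound (`|s| / t).
have := step n; move/(integrable_dominated _); apply; first exact: orl_measurable.
move=> x Ix; rewrite ger0_norm ?(orl_ge0 hm)// -orl_norm normrM (ger0_norm (w0 x)).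
apply: (orl_le hm); first by rewrite mulr_ge0.
rewrite ler_wpM2r// -ler_pdivrMr//; apply: ltW.
apply: (lt_le_trans (archi_boundP _)); first by rewrite divr_ge0// ltW.
by rewrite -natrX ler_nat ltnW// ltn_expl.
Qed.

(** Convexity of the modular, jointly in the function and in the parameter.
    The triangle inequality and the convexity of the norm are instances. *)
Lemma modular_conv u v w s p q th :
  orlicz_class m u -> orlicz_class m v -> orlicz_class m w ->
  0 <= s -> 0 <= th <= 1 ->
  (forall x, s * w x <= th * (p * u x) + (1 - th) * (q * v x)) ->
  modular m w s <= th * modular m u p + (1 - th) * modular m v q.
Proof.
move=> cu cv cw s0 th01 le; rewrite /modular -Rintegral_lincomb; [|exact: ocl_int..].
apply: le_Rintegral; [exact: measurable_unit_itv|exact: ocl_int| |].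
  by apply: integrable_lincomb; exact: ocl_int.
move=> x Ix; apply: le_trans (orl_convex hm _ _ th01).
by apply: (orl_le hm) => //; rewrite mulr_ge0// (ocl_ge0 cw).
Qed.

Lemma orlicz_class_add u v w a b :
  orlicz_class m u -> orlicz_class m v -> measurable_unit w ->
  (forall x, 0 <= w x) -> (forall x, w x <= a * u x + b * v x) -> orlicz_class m w.
Proof.
move=> cu cv mw w0 wuv; apply: (@orlicz_class_of w 1) => //.
have := integrable_lincomb 2^-1 2^-1 (ocl_int cu (2 * a)) (ocl_int cv (2 * b)).
move/(integrable_dominated _); apply; first exact: orl_measurable.
move=> x Ix; rewrite ger0_norm ?(orl_ge0 hm)// mul1r.
have th01 : 0 <= (2^-1 : R) <= 1 by lra.
have := orl_convex hm (2 * a * u x) (2 * b * v x) th01.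
rewrite [1 - 2^-1](_ : _ = 2^-1 :> R); last by field.
move/(le_trans _); apply; apply: (orl_le hm) => //.
apply: le_trans (wuv x) _; lra.
Qed.

Section OneFunction.
Variable (w : R -> R).
Hypothesis cw : orlicz_class m w.
Local Notation J := (modular m w).

Lemma modularE t : (J t)%:E = (\int[mu]_(x in I) (m (t * w x))%:E)%E.
Proof.
rewrite /modular /Rintegral fineK//.
by apply: integrable_fin_num; [exact: measurable_unit_itv|exact: ocl_int].
Qed.

Lemma modular_ge0 t : 0 <= J t.
Proof. by apply: Rintegral_ge0 => x _; exact: (orl_ge0 hm). Qed.

Lemma modular0 : J 0 = 0.
Proof.
rewrite /modular; under eq_Rintegral do rewrite mul0r (orl_0 hm).
exact: Rintegral_cst_unit.
Qed.

Lemma modular_star s t : 0 <= s <= 1 -> 0 <= t -> J (s * t) <= s * J t.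
Proof.
move=> /andP[s0 s1] t0; have := @modular_conv w w w (s * t) t 0 s cw cw cw.
rewrite modular0 mulr0 addr0 s0 s1 mulr_ge0// => /(_ isT isT); apply => x.
by rewrite mul0r mulr0 addr0 mulrA.
Qed.

(** A Lipschitz estimate for the modular, with a constant controlled by
    [modular_Delta2]. *)
Lemma modular_slope s t : 0 <= s -> s <= t -> t * (J t - J s) <= (t - s) * J (2 * t).
Proof.
move=> s0 st; have mI := measurable_unit_itv R.
have e : t * (J t - J s) =
    \int[mu]_(x in I) (t * m (t * w x) + (- t) * m (s * w x)).
  by rewrite Rintegral_lincomb; [rewrite /modular; ring|exact: ocl_int..].
have e2 : (t - s) * J (2 * t) =
    \int[mu]_(x in I) ((t - s) * m (2 * t * w x) + 0 * m (s * w x)).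
  by rewrite Rintegral_lincomb; [rewrite /modular; ring|exact: ocl_int..].
rewrite e e2; apply: le_Rintegral => //.
- by apply: integrable_lincomb; exact: ocl_int.
- by apply: integrable_lincomb; exact: ocl_int.
move=> x Ix; have := orl_slope hm s0 st (ocl_ge0 cw x); rewrite !mulrA; lra.
Qed.

Lemma modular_Delta2 t : 0 <= t -> J (2 * t) <= k * J t + c.
Proof.
move=> t0; have := @Rintegral_lincomb R (fun x => m (t * w x)) (cst c) k 1
  (ocl_int cw t) (integrable_cst_unit c).
rewrite /= Rintegral_cst_unit [1 * c in RHS]mul1r => <-.
apply: le_Rintegral; [exact: measurable_unit_itv|exact: ocl_int| |].
  exact: (@integrable_lincomb R (fun x => m (t * w x)) (cst c) k 1
    (ocl_int cw t) (integrable_cst_unit c)).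
by move=> x Ix; rewrite ?mul1r -mulrA hD2// mulr_ge0// (ocl_ge0 cw).
Qed.

Lemma modular_continuous : continuous J.
Proof.
move=> t; pose X := `|t| + 1.
have tX : t \in (`]- X, X[%classic : set R).
  rewrite inE /= in_itv /= /X -ltr_norml; lra.
apply: (@continuity_under_integral _ _ _ mu (fun s x => m (s * w x)) I
  (measurable_unit_itv R) (- X) X _ _ (fun x => m (X * w x)) _ _ _ tX).
- by move=> s _; exact: ocl_int.
- apply: aeW => x Ix s _; have h1 := @mulrr_continuous R (w x) s.
  have h2 := is_derive1_continuous (orl_d1 hm (s * w x)).
  exact: (continuous_comp h1 h2).
- exact: ocl_int.
- move=> s; rewrite /= in_itv /= -ltr_norml => sX; apply: aeW => x Ix.
  rewrite ger0_norm ?(orl_ge0 hm)// -orl_norm normrM (ger0_norm (ocl_ge0 cw x)).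
  apply: (orl_le hm); first by rewrite mulr_ge0// (ocl_ge0 cw).
  by rewrite ler_wpM2r// ?(ocl_ge0 cw)// ltW.
Qed.

Lemma modular_gt0 t : 0 < t ->
  ~ {ae mu, forall x, I x -> w x = 0} -> 0 < J t.
Proof.
move=> t0 wn0; rewrite lt_neqAle modular_ge0 andbT eq_sym; apply/negP => /eqP Jt.
apply: wn0.
have mi : measurable_unit (fun x => (m (t * w x))%:E).
  by apply/measurable_EFinP; exact: orl_measurable (ocl_meas cw).
have := (ae_eq_integral_abs mu (measurable_unit_itv R) mi).1.
rewrite (_ : (\int[mu]_(x in I) `|(m (t * w x))%:E|)%E = 0%E); last first.
  transitivity (J t)%:E; last by rewrite Jt.
  by rewrite modularE; apply: eq_integral => x _; rewrite gee0_abs// lee_fin (orl_ge0 hm).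
move=> /(_ erefl); apply: filterS => x h Ix; have [m0] := h Ix.
apply/eqP; case: (eqVneq (w x) 0) => // wx0.
have : 0 < m (t * w x).
  by apply: (orl_gt0 hm); rewrite mulr_gt0// lt_neqAle eq_sym wx0 (ocl_ge0 cw).
by rewrite m0 ltxx.
Qed.

Lemma modular_eq1 : ~ {ae mu, forall x, I x -> w x = 0} ->
  exists2 T, 0 < T & J T = 1.
Proof.
move=> wn0; have J1 := modular_gt0 ltr01 wn0.
(* [J] is at least [1] at this point because [J] is star-shaped: [J X >= X J 1]. *)
pose X := Num.max 1 (J 1)^-1.
have X1 : 1 <= X by rewrite le_max lexx.
have X0 : 0 < X by lra.
have JX : 1 <= J X.
  have h : 0 <= X^-1 <= 1 by rewrite invr_ge0 ltW//= invf_le1.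
  have := modular_star h (ltW X0); rewrite mulVf ?gt_eqF// mulrC ler_pdivlMr// => h1.
  apply: le_trans h1; rewrite mulrC -ler_pdivrMr// mul1r le_max lexx orbT //.
have [||T] := @IVT _ J 0 X 1 (ltW X0).
- by apply: continuous_subspaceT; exact: modular_continuous.
- by rewrite modular0 ge_min ler01 le_max JX orbT.
rewrite in_itv /= => /andP[T0 _] JT; exists T => //.
rewrite lt_neqAle T0 andbT eq_sym; apply/eqP => T00.
by move: JT; rewrite T00 modular0 => /eqP; rewrite eq_sym oner_eq0.
Qed.

Lemma modular_le1 T s : 0 < T -> J T = 1 -> 0 < s -> J s <= 1 -> s <= T.
Proof.
move=> T0 JT s0; apply: contraTT; rewrite -!ltNge => Ts.
have h : 0 <= T / s <= 1 by rewrite divr_ge0 ?(ltW T0) ?(ltW s0)//= ler_pdivrMr// mul1r ltW.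
have := modular_star h (ltW s0); rewrite divfK ?gt_eqF// JT => h1.
have Ts1 : T / s < 1 by rewrite ltr_pdivrMr// mul1r.
have Ts0 : 0 < T / s by rewrite divr_gt0.
rewrite -(ltr_pM2l Ts0) mulr1; exact: lt_le_trans h1.
Qed.

End OneFunction.

End Modular.

(** * The modulus and the norm along a line *)

Section Modulus.
Context {R : realType} {K : scalars}.
Implicit Types x y z : scalar_space R K.

Lemma modulus_ge0 x : 0 <= modulus x.
Proof. by case: K x => /= x; exact: normr_ge0. Qed.

Lemma modulusD x y : modulus (x + y) <= modulus x + modulus y.
Proof. by case: K x y => /= x y; exact: ler_normD. Qed.

Lemma modulus_eq0 x : (modulus x == 0) = (x == 0).
Proof. by case: K x => /= x; exact: normr_eq0. Qed.

Lemma modulus_complexE (z : Rcomplex R) :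
  modulus (K := ComplexScalars) z = Num.sqrt (complex.Re z ^+ 2 + complex.Im z ^+ 2).
Proof. by case: z. Qed.

Lemma modulusZ (a : R) x : modulus (a *: x) = `|a| * modulus x.
Proof.
case: K x => /= x; first exact: normrM.
rewrite -[LHS]/(modulus (K := ComplexScalars) _) -[X in _ * X]/(modulus (K := ComplexScalars) _).
rewrite !modulus_complexE !linearZ /= !exprMn -mulrDr sqrtrM ?sqr_ge0//.
by rewrite sqrtr_sqr.
Qed.

Lemma modulus_conv_sqr (a : R) x y :
  modulus (a *: x + (1 - a) *: y) ^+ 2 =
  a * modulus x ^+ 2 + (1 - a) * modulus y ^+ 2 - a * (1 - a) * modulus (x - y) ^+ 2.
Proof.
case: K x y => /= x y.
  by rewrite !real_normK ?num_real// /GRing.scale /=; ring.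
rewrite -!/(modulus (K := ComplexScalars) _) !modulus_complexE.
rewrite !sqr_sqrtr ?addr_ge0 ?sqr_ge0//.
by case: x y => [x1 x2] [y1 y2] /=; ring.
Qed.

Lemma measurable_modulus (f : R -> scalar_space R K) :
  measurable_scalar f -> measurable_unit (fun x : R => modulus (f x)).
Proof.
case: K f => /= f; first by move=> mf; exact: measurableT_comp.
move=> [m1 m2].
have -> : (fun x : R => `|f x|) =
  Num.sqrt \o (fun x : R => complex.Re (f x) ^+ 2 + complex.Im (f x) ^+ 2).
  by apply/funext => x; exact: modulus_complexE.
apply: measurableT_comp; first by apply: continuous_measurable_fun; exact: sqrt_continuous.
by apply: measurable_funD; exact: measurable_funX.
Qed.

Lemma measurable_scalar_line (f g : R -> scalar_space R K) (a : R) :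
  measurable_scalar f -> measurable_scalar g ->
  measurable_scalar (fun x : R => f x + a *: g x).
Proof.
case: K f g => /= f g mf mg.
  by apply: measurable_funD => //; exact: measurable_funM.
move: mf mg => [f1 f2] [g1 g2]; split.
  have -> : (fun x : R => complex.Re (f x + a *: g x)) =
      (fun x : R => complex.Re (f x) + a * complex.Re (g x)).
    by apply/funext => t; case: (f t) (g t) => [? ?] [? ?].
  by apply: measurable_funD => //; exact: measurable_funM.
have -> : (fun x : R => complex.Im (f x + a *: g x)) =
      (fun x : R => complex.Im (f x) + a * complex.Im (g x)).
    by apply/funext => t; case: (f t) (g t) => [? ?] [? ?].
by apply: measurable_funD => //; exact: measurable_funM.
Qed.

End Modulus.

Section LuxemburgNorm.
Context {R : realType} {K : scalars} (M : R -> R).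
Local Notation m := (even_ext M).
Local Notation m1 := (even_ext1 M).
Local Notation m2 := (even_ext2 M).
Context (hm : even_C2_orlicz m m1 m2) {k c : R}
  (hD2 : forall u, 0 <= u -> m (2 * u) <= k * m u + c).
Local Notation mu := (@lebesgue_measure R).
Local Notation I := (unit_itv R).
Implicit Types f g : R -> scalar_space R K.

Local Notation md f := (fun x : R => modulus (f x)).

Lemma luxemburg_integrand f l : 0 < l ->
  (\int[mu]_(x in I) (M (modulus (f x) / l))%:E =
   \int[mu]_(x in I) (m (l^-1 * modulus (f x)))%:E)%E.
Proof.
move=> l0; apply: eq_integral => x _.
by rewrite /even_ext ger0_norm 1?mulrC// mulr_ge0 ?modulus_ge0// invr_ge0 ltW.
Qed.

Lemma orlicz_class_modulus f : in_orlicz_space M f -> orlicz_class m (md f).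
Proof.
move=> [mf]; have mw := measurable_modulus mf.
rewrite /luxemburg_norm => /ereal_inf_lt [_ [l [l0 fl] <-] _].
move: fl; rewrite luxemburg_integrand// => fl.

apply: (orlicz_class_of hm hD2 (t := l^-1) mw); rewrite ?invr_gt0//.
  by move=> x; exact: modulus_ge0.
apply/integrableP; split.
  by apply/measurable_EFinP; exact: (orl_measurable hm).
under eq_integral do rewrite gee0_abs ?lee_fin ?(orl_ge0 hm)//.
by apply: le_lt_trans fl _; rewrite ltry.
Qed.

(** If the modular takes the value [1] at [T > 0], it exceeds [1] beyond [T],
    so the infimum defining the norm is [1 / T]. *)
Lemma luxemburg_normE f T : orlicz_class m (md f) -> 0 < T -> modular m (md f) T = 1 ->
  luxemburg_norm M f = (T^-1)%:E.
Proof.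
move=> cf T0 JT; apply/eqP; rewrite eq_le; apply/andP; split.
  apply: ereal_inf_lbound; exists T^-1 => //; split; first by rewrite invr_gt0.
  by rewrite luxemburg_integrand ?invr_gt0// invrK -(modularE cf) JT.
apply: le_ereal_inf_tmp => _ [l [l0 fl] <-].
move: fl; rewrite luxemburg_integrand// -(modularE cf) lee_fin => fl.
rewrite lee_fin -[leRHS]invrK lef_pV2 ?posrE ?invr_gt0//.
by apply: (modular_le1 hm cf T0 JT) => //; rewrite invr_gt0.
Qed.

Section Line.
Variables f g : R -> scalar_space R K.
Hypotheses (hf : in_orlicz_space M f) (hg : in_orlicz_space M g).
Local Notation N := (norm_along_line M f g).
(** The modulus of [f + a g]. *)
Definition line_modulus (a x : R) : R := modulus (f x + a *: g x).
Local Notation w := line_modulus.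

Lemma orlicz_class_line a : orlicz_class m (w a).
Proof.
have mw : measurable_unit (w a).
  by apply: measurable_modulus; apply: measurable_scalar_line; [case: hf|case: hg].
have h x : w a x <= 1 * modulus (f x) + `|a| * modulus (g x).
  by rewrite mul1r -modulusZ; exact: modulusD.
apply: (orlicz_class_add hm hD2 _ _ mw _ h).
- exact: orlicz_class_modulus.
- exact: orlicz_class_modulus.
- by move=> x; exact: modulus_ge0.
Qed.

(** [f + a g] is not a.e. zero on [[0, 1]]. *)
Definition line_nonnull (a : R) := ~ {ae mu, forall x, I x -> w a x = 0}.

Lemma norm_lineE a T : 0 < T -> modular m (w a) T = 1 -> N a = T^-1.
Proof.
move=> T0 JT; rewrite /norm_along_line.
by rewrite (luxemburg_normE (orlicz_class_line a) T0 JT).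
Qed.

(** Where [f + a g] is not null, the norm is positive and normalizes the
    modular to exactly [1]. *)
Lemma norm_line_spec a : line_nonnull a -> 0 < N a /\ modular m (w a) (N a)^-1 = 1.
Proof.
move=> /(modular_eq1 hm (orlicz_class_line a)) [T T0 JT].
by rewrite (norm_lineE T0 JT) invrK invr_gt0.
Qed.

Lemma norm_line_le a l : line_nonnull a -> 0 < l -> modular m (w a) l^-1 <= 1 -> N a <= l.
Proof.
move=> na l0 Jl; have [N0 JN] := norm_line_spec na.
rewrite -lef_pV2 ?posrE//.
by apply: (modular_le1 hm (orlicz_class_line a) _ JN); rewrite ?invr_gt0.
Qed.

Lemma norm_line_convex a b th : 0 <= th <= 1 ->
  line_nonnull a -> line_nonnull b -> line_nonnull (th * a + (1 - th) * b) ->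
  N (th * a + (1 - th) * b) <= th * N a + (1 - th) * N b.
Proof.
move=> /andP[t0 t1] na nb nab.
have [Na0 Ja] := norm_line_spec na; have [Nb0 Jb] := norm_line_spec nb.
set l := _ + _ * N b.
have l0 : 0 < l.
  rewrite /l; have [->|t00] := eqVneq th 0; first by rewrite mul0r add0r subr0 mul1r.
  have : 0 < th by rewrite lt_neqAle eq_sym t00.
  by move=> th0; rewrite ltr_pwDl ?mulr_gt0// mulr_ge0 ?subr_ge0// ltW.
apply: norm_line_le => //.
(* The weight [th N a / l] matches the normalizations of the two functions. *)
have tau : 0 <= th * N a / l <= 1.
  rewrite divr_ge0 ?mulr_ge0 ?(ltW Na0) ?(ltW l0)//= ler_pdivrMr// mul1r /l lerDl.
  by rewrite mulr_ge0 ?subr_ge0// ltW.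
have := modular_conv (s := l^-1) (p := (N a)^-1) (q := (N b)^-1) hm
  (orlicz_class_line a) (orlicz_class_line b)
  (orlicz_class_line (th * a + (1 - th) * b)) _ tau.
rewrite Ja Jb !mulr1 (addrC (_ / l)) subrK; apply; first by rewrite invr_ge0 ltW.
move=> x.
have -> : th * N a / l * ((N a)^-1 * w a x) +
   (1 - th * N a / l) * ((N b)^-1 * w b x) =
   l^-1 * (th * w a x + (1 - th) * w b x).
  rewrite [1 - th * N a / l](_ : _ = (1 - th) * N b / l); last first.
    apply: (mulIf (lt0r_neq0 l0)); rewrite mulrBl mul1r !divfK ?gt_eqF// /l; ring.
  by field; rewrite !gt_eqF.
rewrite ler_wpM2l// ?invr_ge0 ?(ltW l0)//.
rewrite /line_modulus.
have -> : f x + (th * a + (1 - th) * b) *: g x =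
   th *: (f x + a *: g x) + (1 - th) *: (f x + b *: g x).
  rewrite !scalerDr !scalerA addrACA -!scalerDl; congr (_ + _).
  by rewrite (addrC th) subrK scale1r.
apply: le_trans (modulusD _ _) _.
by rewrite !modulusZ !ger0_norm// subr_ge0.
Qed.

Lemma norm_line_lipschitz : exists2 C, 0 < C & forall a b,
  line_nonnull a -> line_nonnull b -> `|N b - N a| <= C * `|b - a|.
Proof.
have cg := orlicz_class_modulus hg.
(* [C] bounds the norm of [g] and is positive even if [g] is null. *)
pose C := Num.max 1 (modular m (md g) 1).
have C1 : 1 <= C by rewrite le_max lexx.
have C0 : 0 < C by lra.
have JC : modular m (md g) C^-1 <= 1.
  have h : 0 <= C^-1 <= 1 by rewrite invr_ge0 (ltW C0)//= invf_le1.
  have := modular_star hm cg h ler01; rewrite mulr1 => /le_trans; apply.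
  by rewrite mulrC ler_pdivrMr// mul1r le_max lexx orbT.
exists C => //.
suff H a b : line_nonnull a -> line_nonnull b -> N b <= N a + C * `|b - a|.
  move=> a b na nb; have := H a b na nb; have := H b a nb na.
  by rewrite (distrC a b) ler_norml; lra.
move=> na nb; have [Na0 Ja] := norm_line_spec na.
set d := C * _; have d0 : 0 <= d by rewrite mulr_ge0// ltW.
set l := _ + _; have l0 : 0 < l by rewrite ltr_pwDl.
apply: norm_line_le => //.
have tau : 0 <= N a / l <= 1.
  by rewrite divr_ge0 ?(ltW Na0) ?(ltW l0)//= ler_pdivrMr// mul1r /l lerDl.
have := modular_conv (s := l^-1) (p := (N a)^-1) (q := C^-1) hm
  (orlicz_class_line a) cg (orlicz_class_line b) _ tau.
rewrite Ja mulr1 => H.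
have := ler_wpM2l (_ : 0 <= 1 - N a / l) JC.
rewrite mulr1 subr_ge0 => /(_ (andP tau).2) h2.
apply: le_trans (H _ _) _; [by rewrite invr_ge0 ltW| |by lra].
move=> x.
have -> : N a / l * ((N a)^-1 * w a x) +
   (1 - N a / l) * (C^-1 * modulus (g x)) =
   l^-1 * (w a x + `|b - a| * modulus (g x)).
  rewrite [1 - N a / l](_ : _ = d / l); last first.
    apply: (mulIf (lt0r_neq0 l0)); rewrite mulrBl mul1r !divfK ?gt_eqF// /l; ring.
  by rewrite /d; field; rewrite !gt_eqF.
rewrite ler_wpM2l// ?invr_ge0 ?(ltW l0)// /line_modulus.
have -> : f x + b *: g x = (f x + a *: g x) + (b - a) *: g x.
  by rewrite -addrA -scalerDl (addrC a) subrK.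
by apply: le_trans (modulusD _ _) _; rewrite modulusZ.
Qed.

End Line.
End LuxemburgNorm.

(** * Functions of one real variable *)

Section RealLemmas.
Context {R : realType}.
Implicit Types N : R -> R.

Lemma derive0_small N (e : R) : is_derive (0 : R) 1 N 0 -> 0 < e ->
  exists2 r, 0 < r & forall x, `|x| < r -> `|N x - N 0| <= e * `|x|.
Proof.
move=> /is_derive1_caratheodory[s [Ns cs s0]] e0.
have /cvgrPdist_lt /(_ e e0) [r /= r0 hr] := cs.
exists r => // x xr; rewrite Ns subr0 normrM ler_wpM2r//.
have := hr x; rewrite /= sub0r normrN => /(_ xr).
by rewrite s0 sub0r normrN => /ltW.
Qed.

(** A convex function that varies by at most [e |x|] from its value at [0] has
    slopes of size [O(e)] well inside the interval; this replaces continuity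
    of the derivative. *)
Lemma convex_slope_small N (r e : R) : 0 < e ->
  (forall x y th, `|x| < r -> `|y| < r -> 0 <= th <= 1 ->
     N (th * x + (1 - th) * y) <= th * N x + (1 - th) * N y) ->
  (forall x, `|x| < r -> `|N x - N 0| <= e * `|x|) ->
  forall x y, `|x| < r / 4 -> `|y| < r / 4 -> `|N x - N y| <= 3 * e * `|x - y|.
Proof.
move=> e0 cN sN.
suff H x y : `|x| < r / 4 -> `|y| < r / 4 -> x < y -> `|N x - N y| <= 3 * e * (y - x).
  move=> x y xr yr; have [xy|yx|->] := ltgtP x y.
  - by rewrite (distrC x) (gtr0_norm (x := y - x)) ?subr_gt0// H.
  - by rewrite distrC (gtr0_norm (x := x - y)) ?subr_gt0// H.
  - by rewrite !subrr normr0 mulr0.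
move=> xr yr xy.
have r0 : 0 < r by have := normr_ge0 x; lra.
(* Slopes of a convex function increase: compare the chord over [[x, y]] with
   those ending at [r / 2] and at [- r / 2]. *)
have conv3 p q s : `|p| < r -> `|s| < r -> p < q -> q < s ->
    (s - q) * (N q - N p) <= (q - p) * (N s - N q).
  move=> pr sr pq qs; have sp : 0 < s - p by lra.
  have th01 : 0 <= (s - q) / (s - p) <= 1.
    by apply/andP; split; [apply: divr_ge0; lra|rewrite ler_pdivrMr//; lra].
  have := cN p s _ pr sr th01.
  have -> : (s - q) / (s - p) * p + (1 - (s - q) / (s - p)) * s = q.
    by field; rewrite gt_eqF.
  move/(ler_wpM2l (ltW sp)).
  have -> : (s - p) * ((s - q) / (s - p) * N p + (1 - (s - q) / (s - p)) * N s) =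
      (s - q) * N p + (q - p) * N s by field; rewrite gt_eqF.
  lra.
have bd z d : `|z| <= d -> d < r -> `|N z - N 0| <= e * d.
  move=> zd dr; apply: (le_trans (sN _ (le_lt_trans zd dr))).
  by rewrite ler_pM2l.
have nr2 : `|r / 2| = r / 2 by rewrite ger0_norm//; lra.
have nr2' : `|- (r / 2)| = r / 2 by rewrite normrN.
have r2r : r / 2 < r by lra.
have r4r : r / 4 < r by lra.
have xr1 := lt_trans xr r4r; have yr1 := lt_trans yr r4r.
have h1 := conv3 x y (r / 2) xr1 _ xy _.
have h2 := conv3 (- (r / 2)) x y _ yr1 _ xy.
rewrite nr2 in h1; rewrite nr2' in h2.
move: (xr) (yr); rewrite !ltr_norml => /andP[x1 x2] /andP[y1 y2].
have {}h1 := h1 r2r ltac:(lra); have {}h2 := h2 r2r ltac:(lra).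
have := bd x (r / 4) (ltW xr) r4r; have := bd y (r / 4) (ltW yr) r4r.
have := bd (r / 2) (r / 2) _ r2r; have := bd (- (r / 2)) (r / 2) _ r2r.
rewrite nr2 nr2' !lexx => /(_ isT) + /(_ isT).
rewrite !ler_norml => /andP[a1 a2] /andP[b1 b2] /andP[c1 c2] /andP[d1 d2].
have g1 : (y - x) * (N (r / 2) - N y) <= (y - x) * (e * r * (3 / 4)).
  by rewrite ler_pM2l ?subr_gt0//; lra.
have g2 : (y - x) * (N x - N (- (r / 2))) >= (y - x) * (- (e * r * (3 / 4))).
  by rewrite ler_pM2l ?subr_gt0//; lra.
have r4 : 0 < r / 4 by lra.
have P : 0 <= r / 4 * (3 * e * (y - x)).
  by rewrite mulr_ge0 ?(ltW r4)// !mulr_ge0 ?(ltW e0)// subr_ge0 ltW.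
have Q : (y - x) * (e * r * (3 / 4)) = r / 4 * (3 * e * (y - x)) by field.
rewrite Q in g1; rewrite mulrN Q in g2.
clear - h1 h2 g1 g2 r4 P x1 x2 y1 y2.
apply/andP; split; rewrite -(ler_pM2l r4) ?mulrN.
- have [pos|neg] := leP 0 (N y - N x).
    have : (r / 4) * (N y - N x) <= (r / 2 - y) * (N y - N x).
      by rewrite ler_wpM2r//; lra.
    by lra.
  have : 0 <= r / 4 * (N x - N y) by rewrite mulr_ge0 ?(ltW r4)//; lra.
  by lra.
- have [pos|neg] := leP 0 (N x - N y).
    have : (r / 4) * (N x - N y) <= (x - - (r / 2)) * (N x - N y).
      by rewrite ler_wpM2r//; lra.
    by lra.
  have : 0 <= r / 4 * (N y - N x) by rewrite mulr_ge0 ?(ltW r4)//; lra.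
  by lra.
Qed.

(** A quadratic lower bound on symmetric second differences bounds the second
    derivative from below at every point where it exists. *)
Lemma second_derivative_ge N (a c d : R) : 0 < d -> twice_derivable_at N a ->
  (forall h, 0 < h -> h < d -> c * h ^+ 2 <= N (a + h) + N (a - h) - 2 * N a) ->
  c <= N^`(2) a.
Proof.
move=> d0 [nN dN1] hc; rewrite leNgt; apply/negP => lc.
have [l ll] : exists l, l = N^`(2) a by exists (N^`(2) a).
rewrite -ll in lc.
have dN2 : is_derive a 1 (N^`()) l.
  by apply: DeriveDef; [exact: dN1 | rewrite ll -derive1E].
clear ll.
(* Otherwise [p t = N (a + t) + N (a - t) - 2 N a - q t^2] with [l < q < c] has a
   nonpositive derivative for small [t >= 0], hence [p h <= 0]. *)
pose q := (l + c) / 2; have ql : 0 < q - l by rewrite /q; lra.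
have /is_derive1_caratheodory[s [Ns cs sa]] := dN2.
have [r1 /= r10 hN] := nN.
have /cvgrPdist_lt /(_ _ ql) [r2 /= r20 hs] := cs.
pose h := Num.min d (Num.min r1 r2) / 2.
have m0 : 0 < Num.min d (Num.min r1 r2) by rewrite !lt_min d0 r10.
have h0 : 0 < h by rewrite divr_gt0.
have hm : h < Num.min d (Num.min r1 r2) by rewrite /h; lra.
move: hm; rewrite !lt_min => /and3P[hd hr1 hr2].
have dNx x : `|x - a| < r1 -> is_derive x 1 N (N^`() x).
  move=> xa; apply: DeriveDef; first by apply: hN => /=; rewrite distrC.
  by rewrite derive1E.
pose p (t : R) := N (a + t) + N (a - t) - 2 * N a - q * t ^+ 2.
pose p1 (t : R) := derive1 N (a + t) - derive1 N (a - t) - 2 * q * t.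
have dp (t : R) : 0 <= t <= h -> is_derive t 1 p (p1 t).
  move=> /andP[t0 th].
  have D1 : is_derive (a + t) 1 N (derive1 N (a + t)).
    by apply: dNx; rewrite addrAC subrr add0r ger0_norm//; lra.
  have D2 : is_derive (a - t) 1 N (derive1 N (a - t)).
    by apply: dNx; rewrite addrAC subrr add0r normrN ger0_norm//; lra.
  have D1' : is_derive t 1 (N \o (fun t => a + t)) (derive1 N (a + t) * (0 + 1)).
    exact: is_derive1_comp.
  have D2' : is_derive t 1 (N \o (fun t => a - t)) (derive1 N (a - t) * (0 - 1)).
    exact: is_derive1_comp.
  have : is_derive t 1 ((N \o (fun t => a + t)) \+ (N \o (fun t => a - t)) \-
     cst (2 * N a) \- q \*: (fun t => t ^+ 2)) (p1 t).
    by apply: is_derive_eq; rewrite /p1 /GRing.scale /=; ring.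
  by [].
have [t /andP[t0 th]] := MVT_le (ltW h0) dp.
rewrite [p 0](_ : _ = 0); last by rewrite /p addr0 subr0 expr0n /=; ring.
rewrite !subr0 => ph.
have p1t : p1 t <= 0.
  have E1 := Ns (a + t); have E2 := Ns (a - t).
  have := hs (a + t); have := hs (a - t); rewrite /= sa.
  rewrite !opprD !addrA !subrr !add0r opprK normrN ger0_norm//.
  move=> /(_ ltac:(lra)) h1 /(_ ltac:(lra)).
  move: h1; rewrite !ltr_norml => /andP[h1 h2] /andP[h3 h4].
  rewrite /p1; move: E1 E2; rewrite (addrAC a) subrr add0r (addrAC a) subrr add0r => E1 E2.
  have : (s (a + t) + s (a - t) - 2 * q) * t <= 0.
    by rewrite mulr_le0_ge0//; lra.
  clear - E1 E2; lra.
have H1 := hc h h0 hd.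
have H2 : p1 t * h <= 0 by rewrite mulr_le0_ge0// ltW.
have H3 : 0 < (c - q) * h ^+ 2 by rewrite mulr_gt0 ?exprn_gt0//; rewrite /q; lra.
clear - H1 H2 H3 ph; move: ph; rewrite /p; lra.
Qed.

Lemma full_measure_near0 (E : set R) (d : R) : measurable E -> E `<=` `[0, 1] ->
  @lebesgue_measure R E = 1%E -> 0 < d -> exists2 a, E a & 0 < a < d.
Proof.
move=> mE E01 E1 d0; apply: contrapT => nE.
pose e := Num.min d 1.
have e0 : 0 < e by rewrite lt_min d0 ltr01.
have e1 : e <= 1 by rewrite ge_min lexx orbT.
have sub : E `<=` (`[0, 0]%classic `|` `[e, 1]%classic : set R).
  move=> a Ea; have := E01 a Ea; rewrite /= !in_itv /= => /andP[a0 a1].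
  have [a00|aN0] := eqVneq a 0; [left; rewrite a00 lexx//|right].
  rewrite a1 andbT leNgt; apply/negP => ae; apply: nE; exists a => //.
  rewrite lt_neqAle eq_sym aN0 a0 /=; apply: (lt_le_trans ae).
  by rewrite ge_min lexx.
have m0 : @measurable _ (measurableTypeR R) `[0, 0]%classic by exact: measurable_itv.
have me : @measurable _ (measurableTypeR R) `[e, 1]%classic by exact: measurable_itv.
have le1 : (@lebesgue_measure R E <=
    @lebesgue_measure R (`[0%R, 0%R]%classic `|` `[e, 1%R]%classic))%E.
  by apply: le_measure => //; rewrite inE //; exact: measurableU.
have le2 := measureU2 (@lebesgue_measure R) m0 me.
have z1 : (@lebesgue_measure R `[0%R, 0%R]%classic <= 0)%E.
  by rewrite lebesgue_measure_itv /= lte_fin ltxx.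
have z2 : (@lebesgue_measure R `[e, 1%R]%classic <= (1 - e)%:E)%E.
  rewrite lebesgue_measure_itv /= lte_fin.
  by case: ifP => [_|/negbT]; rewrite -?EFinB// -leNgt lee_fin; lra.
have := le_trans le1 (le_trans le2 (leeD z1 z2)); rewrite add0e.
by rewrite E1 lee_fin; lra.
Qed.

End RealLemmas.

(** * Strong convexity on the overlap of the supports *)

(** Combinations of points of an affine line, in coordinates. *)
Lemma scale_line2 (R : pzRingType) (V : lmodType R) (F G : V) (al b be c : R) :
  al *: (F + b *: G) + be *: (F + c *: G) = (al + be) *: F + (al * b + be * c) *: G.
Proof. by rewrite !scalerDr !scalerA addrACA -!scalerDl. Qed.

Section VectorConvexity.
Context {R : realType} {K : scalars} {m m1 m2 : R -> R} (hm : even_C2_orlicz m m1 m2).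
Implicit Types u v : scalar_space R K.

Lemma orl_modulus_convex th u v : 0 <= th <= 1 ->
  m (modulus (th *: u + (1 - th) *: v)) <= th * m (modulus u) + (1 - th) * m (modulus v).
Proof.
move=> th01; apply: le_trans (orl_convex hm _ _ th01).
apply: (orl_le hm (modulus_ge0 _)).
case/andP: th01 => t0 t1; apply: le_trans (modulusD _ _) _.
by rewrite !modulusZ !ger0_norm// subr_ge0.
Qed.

(** Strong convexity of [m o modulus] on an annulus. The defect is an exact
    Hilbert-space identity ([modulus_conv_sqr]), which covers the radial and
    the tangential directions at once. *)
Lemma orl_modulus_strong_convex (a b : R) : 0 < a -> a <= b -> exists2 c, 0 < c &
  forall th u v, 0 <= th <= 1 -> a <= modulus u <= b -> a <= modulus v <= b ->
  a <= modulus (th *: u + (1 - th) *: v) <= b ->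
  m (modulus (th *: u + (1 - th) *: v)) + c * (th * (1 - th) * modulus (u - v) ^+ 2) <=
  th * m (modulus u) + (1 - th) * m (modulus v).
Proof.
move=> a0 ab; have [c c0 hc] := orl_strong_convex hm a0 ab.
exists c => // th u v th01 hu hv huv.
have := hc _ _ _ th hu hv huv th01.
rewrite modulus_conv_sqr opprB addrCA subrr addr0; apply.
case/andP: th01 => t0 t1; apply: le_trans (modulusD _ _) _.
by rewrite !modulusZ !ger0_norm// subr_ge0.
Qed.

End VectorConvexity.

Lemma measurable_support {R : realType} {K : scalars} (h : R -> scalar_space R K) :
  measurable_scalar h ->
  @measurable _ (measurableTypeR R) (support01 h).
Proof.
move=> /measurable_modulus mh; have := mh (measurable_unit_itv R) (~` [set 0]).
rewrite (_ : support01 h = unit_itv R `&` (fun x : R => modulus (h x)) @^-1` (~` [set 0])).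
  by apply; apply: measurableC; exact: measurable_set1.
apply/seteqP; split => x [Ix /= hx]; split => //.
  by move=> /= /eqP; rewrite modulus_eq0; exact/negP.
by apply/negP; rewrite -modulus_eq0 => /eqP.
Qed.

Section Overlap.
Context {R : realType} {K : scalars} (M : R -> R).
Local Notation m := (even_ext M).
Local Notation m1 := (even_ext1 M).
Local Notation m2 := (even_ext2 M).
Context (hm : even_C2_orlicz m m1 m2) {k c : R}
  (hD2 : forall u : R, 0 <= u -> m (2 * u) <= k * m u + c).
Local Notation mu := (@lebesgue_measure R).
Local Notation I := (unit_itv R).
Variables f g : R -> scalar_space R K.
Hypotheses (hf : in_orlicz_space M f) (hg : in_orlicz_space M g).
Local Notation N := (norm_along_line M f g).
Local Notation w := (line_modulus f g).

(** If the supports overlap, both moduli are bounded above and away from zero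
    on a common set of positive measure. *)
Lemma overlap_set : ~ disjoint_supports f g ->
  exists kap (S : set R), [/\ 1 <= kap, @measurable _ (measurableTypeR R) S, S `<=` I,
    mu S != 0%E &
    forall x, S x -> kap^-1 <= modulus (f x) <= kap /\ kap^-1 <= modulus (g x) <= kap].
Proof.
move=> nd; have mf := measurable_modulus hf.1; have mg := measurable_modulus hg.1.
pose S (n : nat) : set R := I `&` ((fun x : R => modulus (f x)) @^-1` `[n.+1%:R^-1, n.+1%:R])
   `&` (I `&` ((fun x : R => modulus (g x)) @^-1` `[n.+1%:R^-1, n.+1%:R])).
have mS n : @measurable _ (measurableTypeR R) (S n).
  have mI := measurable_unit_itv R.
  by apply: measurableI; [apply: mf|apply: mg] => //; exact: measurable_itv.
have [[n Sn]|nS] := pselect (exists n, mu (S n) != 0%E).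
  exists n.+1%:R, (S n); split => //.
  - by rewrite ler1n.
  - by move=> x [[]].
  - by move=> x [[_ /=] + [_ /=]]; rewrite !in_itv.
exfalso; apply: nd; rewrite /disjoint_supports.
have sub : support01 f `&` support01 g `<=` \bigcup_n S n.
  move=> x [[Ix fx] [_ gx]].
  have f0 : 0 < modulus (f x) by rewrite lt_neqAle eq_sym modulus_eq0 fx modulus_ge0.
  have g0 : 0 < modulus (g x) by rewrite lt_neqAle eq_sym modulus_eq0 gx modulus_ge0.
  pose X := Num.max (Num.max (modulus (f x)) (modulus (f x))^-1)
     (Num.max (modulus (g x)) (modulus (g x))^-1).
  have X0 : 0 <= X by rewrite !le_max (ltW f0).
  exists (Num.bound X) => //.
  have : X <= (Num.bound X).+1%:R.
    by apply: ltW; apply: (lt_le_trans (archi_boundP X0)); rewrite ler_nat.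
  rewrite !ge_max => /andP[/andP[a1 a2] /andP[b1 b2]].
  have p0 : 0 < (Num.bound X).+1%:R :> R by rewrite ltr0n.
  split; split => //=; rewrite in_itv /=; apply/andP; split => //.
    by rewrite -[leRHS]invrK lef_pV2 ?posrE ?invr_gt0.
  by rewrite -[leRHS]invrK lef_pV2 ?posrE ?invr_gt0.
have neg : mu.-negligible (\bigcup_n S n).
  apply: negligible_bigcup => n; apply/negligibleP => //.
  by apply/eqP/negP => h; apply: nS; exists n; apply/negP.
have mA : @measurable _ (measurableTypeR R) (support01 f `&` support01 g).
  by apply: measurableI; apply: measurable_support; [exact: hf.1|exact: hg.1].
by apply: (measure_negligible mA); exact: negligibleS neg.
Qed.

Section WithOverlap.
Variables (kap : R) (S : set R).
Hypotheses (kap1 : 1 <= kap) (mS : @measurable _ (measurableTypeR R) S)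
  (SI : S `<=` I) (S0 : mu S != 0%E)
  (Sb : forall x, S x ->
     kap^-1 <= modulus (f x) <= kap /\ kap^-1 <= modulus (g x) <= kap).

Lemma line_modulus_overlap a x : `|a| < (2 * kap ^+ 2)^-1 -> S x ->
  (2 * kap)^-1 <= w a x <= 2 * kap.
Proof.
move=> ha /Sb [/andP[f1 f2] /andP[g1 g2]].
have k1 := kap1; have kp : 0 < kap by lra.
have ag : `|a| * modulus (g x) <= (2 * kap)^-1.
  have -> : (2 * kap)^-1 = (2 * kap ^+ 2)^-1 * kap by field; rewrite gt_eqF.
  by apply: ler_pM => //; [exact: modulus_ge0|exact: ltW].
have k2 : (2 * kap)^-1 <= kap.
  by apply: le_trans kap1; rewrite invf_le1 ?mulr_gt0//; lra.
have kk : kap^-1 = 2 * (2 * kap)^-1 by field; rewrite gt_eqF.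
rewrite /line_modulus; apply/andP; split.
- have := modulusD (f x + a *: g x) (- a *: g x).
  by rewrite scaleNr addrK -scaleNr modulusZ normrN; lra.
- by have := modulusD (f x) (a *: g x); rewrite modulusZ; lra.
Qed.

Lemma line_nonnull_overlap a : `|a| < (2 * kap ^+ 2)^-1 -> line_nonnull f g a.
Proof.
move=> ha; rewrite /line_nonnull => -[A [mA A0 sub]].
have k1 := kap1; have kp : 0 < kap by lra.
move/negP: S0; apply; apply/eqP.
apply: (measure_negligible mS); exists A; split => // x Sx; apply: sub => /= /(_ (SI Sx)) w0.
have := line_modulus_overlap ha Sx; rewrite w0 => /andP[h _].
by move: h; rewrite leNgt invr_gt0 mulr_gt0.
Qed.

Lemma integral_indic_unit :
  mu.-integrable I (EFin \o (\1_S : R -> R)) /\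
  0 < \int[mu]_(x in I) (\1_S x : R).
Proof.
have mI := measurable_unit_itv R.
have i1 : mu.-integrable I (EFin \o (\1_S : R -> R)).
  apply: (@integrable_dominated _ _ (cst 1)); [|exact: integrable_cst_unit|].
    exact: measurable_indic.
  by move=> x _; rewrite ger0_norm ?indicE//= lern1 leq_b1.
split=> //; rewrite /Rintegral integral_indic// setIidl//.
apply: fine_gt0; rewrite lt0e S0 measure_ge0 /=.
have : (mu S <= mu I)%E by apply: le_measure => //; rewrite inE.
by rewrite [X in (_ <= X)%E]lebesgue_measure_unit_itv => /le_lt_trans; apply; rewrite ltry.
Qed.

(** The two normalized vectors stay at distance of order [h]: their difference
    is [h (1 / Np + 1 / Nm) G] up to an error coming from [Np - Nm], which the
    choice of [e] keeps below half of the main term. *)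
Lemma chord_gap (F G : scalar_space R K) (N0 e a h Np Nm : R) : 0 < N0 -> 0 < h ->
  e = N0 / (96 * kap ^+ 2) ->
  N0 / 2 <= Np <= 2 * N0 -> N0 / 2 <= Nm <= 2 * N0 -> `|Np - Nm| <= 6 * e * h ->
  kap^-1 <= modulus G -> modulus (F + a *: G) <= 2 * kap ->
  h / (2 * N0 * kap) <=
    modulus (Np^-1 *: (F + (a + h) *: G) - Nm^-1 *: (F + (a - h) *: G)).
Proof.
move=> N00 h0 e_def /andP[p1 p2] /andP[q1 q2] hN hG hF.
have k1 := kap1; have kp : 0 < kap by lra.
have Np0 : 0 < Np by lra.
have Nm0 : 0 < Nm by lra.
set p := Np^-1; set q := Nm^-1.
have p0 : (2 * N0)^-1 <= p by rewrite lef_pV2 ?posrE ?mulr_gt0.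
have q0 : (2 * N0)^-1 <= q by rewrite lef_pV2 ?posrE ?mulr_gt0.
have e0 : 0 < e by rewrite e_def divr_gt0 ?mulr_gt0 ?exprn_gt0.
have pq : `|p - q| <= 24 * e * h / N0 ^+ 2.
  have -> : p - q = (Nm - Np) * (p * q) by rewrite /p /q; field; rewrite !gt_eqF.
  rewrite normrM (distrC Nm) (ger0_norm (x := p * q)); last first.
    by rewrite mulr_ge0// invr_ge0 ltW.
  have -> : 24 * e * h / N0 ^+ 2 = (6 * e * h) * ((N0 / 2)^-1 * (N0 / 2)^-1).
    by field; rewrite gt_eqF.
  have V x : N0 / 2 <= x -> 0 < x -> x^-1 <= (N0 / 2)^-1.
    by move=> ? ?; rewrite lef_pV2 ?posrE ?divr_gt0.
  apply: ler_pM => //; first by rewrite mulr_ge0// invr_ge0 ltW.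
  by apply: ler_pM; rewrite ?V// invr_ge0 ltW.
have -> : p *: (F + (a + h) *: G) - q *: (F + (a - h) *: G) =
    (p - q) *: (F + a *: G) + (h * (p + q)) *: G.
  rewrite -scaleNr scale_line2 scalerDr scalerA -addrA -scalerDl.
  by congr (_ + _ *: _); ring.
have := modulusD ((p - q) *: (F + a *: G) + (h * (p + q)) *: G) (- (p - q) *: (F + a *: G)).
rewrite scaleNr addrAC subrr add0r -scaleNr !modulusZ normrN.
have pq0 : 0 <= p + q by rewrite addr_ge0// invr_ge0 ltW.
rewrite (ger0_norm (x := h * (p + q))); last by rewrite mulr_ge0// ltW.
have A1 : `|p - q| * modulus (F + a *: G) <= 24 * e * h / N0 ^+ 2 * (2 * kap).
  by apply: ler_pM => //; exact: modulus_ge0.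
have A2 : h * N0^-1 * kap^-1 <= h * (p + q) * modulus G.
  apply: ler_pM => //; [|by rewrite invr_ge0 ltW|].
    by rewrite mulr_ge0 ?invr_ge0 ?ltW.
  rewrite ler_pM2l//; have -> : N0^-1 = (2 * N0)^-1 + (2 * N0)^-1 by field; rewrite gt_eqF.
  exact: lerD.
have A3 : 24 * e * h / N0 ^+ 2 * (2 * kap) = h / (2 * N0 * kap).
  by rewrite e_def; field; rewrite !gt_eqF.
have A4 : h * N0^-1 * kap^-1 = 2 * (h / (2 * N0 * kap)).
  by field; rewrite !gt_eqF.
lra.
Qed.

(** The average of the two norms is the normalization for which the middle
    vector is a convex combination of the normalized end vectors. *)
Lemma midpoint_line (F G : scalar_space R K) (a h Np Nm : R) : 0 < Np -> 0 < Nm ->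
  Np / (Np + Nm) *: (Np^-1 *: (F + (a + h) *: G)) +
    (1 - Np / (Np + Nm)) *: (Nm^-1 *: (F + (a - h) *: G)) =
  ((Np + Nm) / 2)^-1 *: (F + a *: G).
Proof.
move=> p0 q0; have pq : 0 < Np + Nm by rewrite addr_gt0.
rewrite !scalerA scale_line2 scalerDr scalerA.
by congr (_ *: _ + _ *: _); field; rewrite !gt_eqF.
Qed.

(** The middle function, divided by the average of the norms, has modular less
    than [1] by an amount of order [h^2]. Convexity is used everywhere and
    strong convexity on [S]. *)
Lemma modular_midpoint_gap (N0 e h a Np Nm : R) (A := (4 * kap * N0)^-1) (B := 4 * kap / N0)
    (cs : R) : 0 < N0 -> 0 < h -> 0 < cs ->
  (forall th (u v : scalar_space R K), 0 <= th <= 1 ->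
    A <= modulus u <= B -> A <= modulus v <= B ->
    A <= modulus (th *: u + (1 - th) *: v) <= B ->
    m (modulus (th *: u + (1 - th) *: v)) + cs * (th * (1 - th) * modulus (u - v) ^+ 2) <=
    th * m (modulus u) + (1 - th) * m (modulus v)) ->
  e = N0 / (96 * kap ^+ 2) ->
  N0 / 2 <= Np <= 2 * N0 -> N0 / 2 <= Nm <= 2 * N0 -> `|Np - Nm| <= 6 * e * h ->
  `|a| < (2 * kap ^+ 2)^-1 -> `|a + h| < (2 * kap ^+ 2)^-1 ->
  `|a - h| < (2 * kap ^+ 2)^-1 ->
  modular m (w (a + h)) Np^-1 = 1 -> modular m (w (a - h)) Nm^-1 = 1 ->
  modular m (w a) ((Np + Nm) / 2)^-1 +
    cs / 64 * (h / (2 * N0 * kap)) ^+ 2 * (\int[mu]_(x in I) (\1_S x : R)) <= 1.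
Proof.
move=> N00 h0 cs0 hcs e_def bp bm hN ha hp hq Jp Jm.
have [p1 p2] := andP bp; have [q1 q2] := andP bm.
have Np0 : 0 < Np by lra.
have Nm0 : 0 < Nm by lra.
have k1 := kap1; have kp : 0 < kap by lra.
set gain := cs / 64 * _; set Nb := (Np + Nm) / 2.
have Nb1 : N0 / 2 <= Nb <= 2 * N0 by rewrite /Nb; lra.
pose th := Np / (Np + Nm).
have pq0 : 0 < Np + Nm by lra.
have th01 : 0 <= th <= 1.
  by rewrite /th divr_ge0 ?(ltW Np0) ?(ltW pq0)//= ler_pdivrMr// mul1r; lra.
(* The weights stay away from [0] and [1], the two norms being comparable. *)
have th64 : 64^-1 <= th * (1 - th).
  have -> : th * (1 - th) = Np * Nm / (Np + Nm) ^+ 2 by rewrite /th; field; rewrite gt_eqF.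
  rewrite ler_pdivlMr ?exprn_gt0//.
  have h1 : (Np + Nm) ^+ 2 <= (4 * N0) ^+ 2 by rewrite ler_sqr ?nnegrE//; lra.
  have h2 : (N0 / 2) * (N0 / 2) <= Np * Nm by apply: ler_pM; lra.
  lra.
have [iS _] := integral_indic_unit.
have ia := ocl_int (orlicz_class_line hm hD2 hf hg a) Nb^-1.
have ip := ocl_int (orlicz_class_line hm hD2 hf hg (a + h)) Np^-1.
have iq := ocl_int (orlicz_class_line hm hD2 hf hg (a - h)) Nm^-1.
have F := Rintegral_lincomb th (1 - th) ip iq.
rewrite -!/(modular _ _ _) Jp Jm !mulr1 (addrC th) subrK in F.
have E := Rintegral_lincomb 1 gain ia iS.
rewrite -!/(modular _ _ _) [X in _ = X + _]mul1r in E.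
rewrite -[leLHS]E -[leRHS]F.
apply: le_Rintegral; [exact: measurable_unit_itv|exact: integrable_lincomb|
  exact: integrable_lincomb|].
move=> x Ix; rewrite mul1r.
pose u := Np^-1 *: (f x + (a + h) *: g x); pose v := Nm^-1 *: (f x + (a - h) *: g x).
have mod_line s t : 0 < s -> modulus (s^-1 *: (f x + t *: g x)) = s^-1 * w t x.
  by move=> s0; rewrite modulusZ ger0_norm// invr_ge0 ltW.
have Nb0 : 0 < Nb by lra.
have mid : th *: u + (1 - th) *: v = Nb^-1 *: (f x + a *: g x) by exact: midpoint_line.
rewrite -!mod_line// -mid.
have [Sx|nSx] := boolP (x \in S); last first.
  rewrite indicE (negbTE nSx) mulr0 addr0; exact: (orl_modulus_convex hm).
rewrite indicE Sx mulr1; have {}Sx := set_mem Sx.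
have range s t : N0 / 2 <= s <= 2 * N0 -> `|t| < (2 * kap ^+ 2)^-1 ->
    A <= modulus (s^-1 *: (f x + t *: g x)) <= B.
  move=> /andP[s1 s2] ht; have s0 : 0 < s by lra.
  rewrite mod_line//; have /andP[w1 w2] := line_modulus_overlap ht Sx.
  have si : 0 <= s^-1 by rewrite invr_ge0 ltW.
  apply/andP; split.
    have -> : A = (2 * N0)^-1 * (2 * kap)^-1 by rewrite /A; field; rewrite !gt_eqF.
    apply: ler_pM => //.
    - by rewrite invr_ge0 mulr_ge0 ?ltW.
    - by rewrite invr_ge0 mulr_ge0 ?ltW.
    - by rewrite lef_pV2 ?posrE ?mulr_gt0.
  have -> : B = (N0 / 2)^-1 * (2 * kap) by rewrite /B; field; rewrite gt_eqF.
  apply: ler_pM => //; first exact: modulus_ge0.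
  by rewrite lef_pV2 ?posrE ?divr_gt0.
have r3 : A <= modulus (th *: u + (1 - th) *: v) <= B by rewrite mid; exact: range.
apply: le_trans (hcs th u v th01 (range _ _ bp hp) (range _ _ bm hq) r3).
rewrite lerD2l /gain -mulrA ler_pM2l//.
have [_ /andP[G1 _]] := Sb Sx.
have /andP[_ F1] := line_modulus_overlap ha Sx.
have gap := chord_gap N00 h0 e_def bp bm hN G1 F1.
apply: ler_pM => //; first by rewrite sqr_ge0.
have g0 : 0 <= h / (2 * N0 * kap) by rewrite divr_ge0 ?mulr_ge0 ?ltW.
rewrite ler_sqr ?nnegrE ?modulus_ge0//.
Qed.

End WithOverlap.
End Overlap.

(** * Second differences of the norm *)

(** With [j] the modular at [1 / Nb], normalized to [1] at [1 / Na], a defect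
    [d] of the modular forces a gap of the same order between [Na] and [Nb].
    The second bound on [1 - j] is the Lipschitz estimate [modular_slope]. *)
Lemma norm_gap_ge (R : realType) (Na Nb D j d N0 : R) : 0 < Na -> Na <= Nb ->
  N0 / 2 <= Nb -> 0 < D -> 0 <= d -> d <= 1 - j ->
  Na^-1 * (1 - j) <= (Na^-1 - Nb^-1) * D -> N0 * d / D <= 2 * (Nb - Na).
Proof.
move=> Na0 NaNb Nb0 D0 d0 dj sl; have Nbp : 0 < Nb := lt_le_trans Na0 NaNb.
have ta : 0 <= Na^-1 by rewrite invr_ge0 ltW.
have {}sl := ler_wpM2l (ltW (mulr_gt0 Na0 Nbp)) (le_trans (ler_wpM2l ta dj) sl).
have e1 : Na * Nb * (Na^-1 * d) = Nb * d by field; rewrite gt_eqF.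
have e2 : Na * Nb * ((Na^-1 - Nb^-1) * D) = (Nb - Na) * D by field; rewrite !gt_eqF.
rewrite e1 e2 in sl; rewrite ler_pdivrMr//.
by have := ler_wpM2r d0 Nb0; lra.
Qed.

Section ConverseDirection.
Context {R : realType} {K : scalars} (M : R -> R).
Local Notation m := (even_ext M).
Local Notation m1 := (even_ext1 M).
Local Notation m2 := (even_ext2 M).
Context (hm : even_C2_orlicz m m1 m2) {k c : R} (k0 : 0 < k) (c0 : 0 <= c)
  (hD2 : forall u : R, 0 <= u -> m (2 * u) <= k * m u + c).
Local Notation mu := (@lebesgue_measure R).
Local Notation I := (unit_itv R).
Variables f g : R -> scalar_space R K.
Hypotheses (hf : in_orlicz_space M f) (hg : in_orlicz_space M g).
Local Notation N := (norm_along_line M f g).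
Local Notation w := (line_modulus f g).

(** Quadratic lower bound on the second differences of the norm, uniform near
    [0]. *)
Lemma second_difference_ge : ~ disjoint_supports f g -> is_derive (0 : R) 1 N 0 ->
  exists d e, [/\ 0 < d, 0 < e & forall a h, `|a| < d -> 0 < h -> h < d ->
    e * h ^+ 2 <= N (a + h) + N (a - h) - 2 * N a].
Proof.
move=> nd dN; have kc0 := k0; have cc0 := c0.
have half_ge (x y z : R) : z <= x -> z <= y -> z <= (x + y) / 2 by lra.
have halfE (x y : R) : 2^-1 * x + (1 - 2^-1) * y = (x + y) / 2 by field.
have doubleE (x y z : R) : x + y - 2 * z = 2 * ((x + y) / 2 - z) by field.
have half01 : 0 <= (2^-1 : R) <= 1 by lra.
have small4 (x y z : R) : 0 < z -> `|x| < z / 8 -> 0 < y -> y < z / 8 ->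
    [/\ `|x| < z, `|x + y| < z / 4 & `|x - y| < z / 4].
  move=> z0 xz y0 yz; split; first lra.
    by apply: le_lt_trans (ler_normD _ _) _; rewrite (gtr0_norm y0); lra.
  by apply: le_lt_trans (ler_normB _ _) _; rewrite (gtr0_norm y0); lra.
have lt_quarter (x z : R) : 0 < z -> x < z / 4 -> x < z by lra.
have [kap [S [kap1 mS SI S0 Sb]]] := overlap_set hf hg nd.
have kp : 0 < kap by lra.
have kp2 : 0 < (2 * kap ^+ 2)^-1 by rewrite invr_gt0 mulr_gt0// exprn_gt0.
have nn t : `|t| < (2 * kap ^+ 2)^-1 -> line_nonnull f g t.
  exact: line_nonnull_overlap kap1 mS SI S0 Sb t.
have spec t (ht : `|t| < (2 * kap ^+ 2)^-1) := norm_line_spec hm hD2 hf hg (nn t ht).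
have [N00 _] : 0 < N 0 /\ _ := spec 0 ltac:(by rewrite normr0).
set N0 := N 0 in N00.
(* This is the slope tolerance required by [chord_gap]. *)
pose ep := N0 / (96 * kap ^+ 2).
have ep0 : 0 < ep by rewrite divr_gt0// mulr_gt0// exprn_gt0.
have epN : ep <= N0 / 96.
  rewrite /ep ler_pM2l// lef_pV2 ?posrE ?mulr_gt0 ?exprn_gt0//.
  by rewrite ler_pMr// exprn_ege1.
have [rho rho0 Nrho] := derive0_small dN ep0.
pose r := Num.min rho (Num.min 1 (2 * kap ^+ 2)^-1).
have r0 : 0 < r by rewrite !lt_min rho0 ltr01.
have rk (t : R) : `|t| < r -> `|t| < (2 * kap ^+ 2)^-1 by rewrite !lt_min => /and3P[].
have sN t : `|t| < r -> `|N t - N 0| <= ep * `|t|.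
  by rewrite !lt_min => /and3P[? _ _]; exact: Nrho.
have cN x y th : `|x| < r -> `|y| < r -> 0 <= th <= 1 ->
    N (th * x + (1 - th) * y) <= th * N x + (1 - th) * N y.
  move=> xr yr /andP[t0 t1].
  have th01 : 0 <= th <= 1 by rewrite t0.
  have := norm_line_convex hm hD2 hf hg th01 (nn _ (rk _ xr)) (nn _ (rk _ yr)); apply.
  apply/nn/rk; apply: le_lt_trans (ler_normD _ _) _.
  rewrite !normrM (ger0_norm t0) (ger0_norm (x := 1 - th)) ?subr_ge0//.
  have h1 : th * `|x| <= th * Num.max `|x| `|y| by rewrite ler_wpM2l// le_max lexx.
  have h2 : (1 - th) * `|y| <= (1 - th) * Num.max `|x| `|y|.
    by rewrite ler_wpM2l ?subr_ge0// le_max lexx orbT.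
  have : Num.max `|x| `|y| < r by rewrite gt_max xr yr.
  move: h1 h2; lra.
have bN t : `|t| < r -> N0 / 2 <= N t <= 2 * N0.
  move=> tr; have := sN t tr; rewrite -/N0.
  have : ep * `|t| <= ep * 1.
    by rewrite ler_pM2l//; move: tr; rewrite !lt_min => /and3P[_ /ltW].
  rewrite mulr1 => h1 /le_trans/(_ h1); rewrite ler_norml => /andP[h2 h3].
  by apply/andP; split; lra.
pose A := (4 * kap * N0)^-1; pose B := 4 * kap / N0.
have A0 : 0 < A by rewrite invr_gt0 !mulr_gt0.
have AB : A <= B.
  have -> : A = (4 * kap)^-1 / N0 by rewrite /A; field; rewrite !gt_eqF.
  rewrite ler_pM2r ?invr_gt0//; apply: (le_trans (y := 1)); last by lra.
  by rewrite invf_le1 ?mulr_gt0//; lra.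
have [cs cs0 hcs] := orl_modulus_strong_convex (K := K) hm A0 AB.
have [_ iS0] := integral_indic_unit mS SI S0.
set sS := \int[mu]_(x in I) _ in iS0.
pose gain := cs / 64 * (2 * N0 * kap)^-1 ^+ 2 * sS.
have gain0 : 0 < gain by rewrite !mulr_gt0// ?exprn_gt0 ?invr_gt0 ?mulr_gt0.
have kc : 0 < k + c by lra.
exists (r / 8), (N0 * gain / (k + c)); split.
- by rewrite divr_gt0.
- by rewrite divr_gt0// mulr_gt0.
move=> a h ar h0 hr.
have [ar' pr qr] := small4 a h r r0 ar h0 hr.
have pr' := lt_quarter _ _ r0 pr; have qr' := lt_quarter _ _ r0 qr.
have hN : `|N (a + h) - N (a - h)| <= 6 * ep * h.
  have := convex_slope_small ep0 cN sN pr qr.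
  rewrite (_ : a + h - (a - h) = 2 * h); last ring.
  rewrite (gtr0_norm (x := 2 * h)) ?mulr_gt0//.
  by rewrite (_ : 3 * ep * (2 * h) = 6 * ep * h)//; ring.
have bp := bN _ pr'; have bq := bN _ qr'.
have [_ Jp] := spec _ (rk _ pr'); have [_ Jq] := spec _ (rk _ qr').
have [Na0 Ja] := spec _ (rk _ ar').
have := modular_midpoint_gap hm hD2 hf hg kap1 mS SI S0 Sb N00 h0 cs0 hcs erefl bp bq hN
  (rk _ ar') (rk _ pr') (rk _ qr') Jp Jq.
rewrite -/sS; set Nb := (_ + _) / 2 => gap.
have Nb0 : N0 / 2 <= Nb by rewrite half_ge//; [case/andP: bp|case/andP: bq].
have NaNb : N a <= Nb.
  have := cN (a + h) (a - h) 2^-1 pr' qr' half01.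
  have -> : 2^-1 * (a + h) + (1 - 2^-1) * (a - h) = a by field.
  by rewrite halfE.
have Nbp : 0 < Nb := lt_le_trans Na0 NaNb.
have cw := orlicz_class_line hm hD2 hf hg a.
have ta : 0 <= (N a)^-1 by rewrite invr_ge0 ltW.
(* Convert the defect of the modular at [1 / Nb] into a lower bound on
   [Nb - N a]. *)
have sl := modular_slope hm cw (s := Nb^-1) (t := (N a)^-1) _ _.
have {}sl := sl ltac:(by rewrite invr_ge0 ltW) ltac:(by rewrite lef_pV2 ?posrE).
rewrite Ja in sl.
have D2 := modular_Delta2 hD2 cw ta; rewrite Ja mulr1 in D2.
have st : 0 <= (N a)^-1 - Nb^-1 by rewrite subr_ge0 lef_pV2 ?posrE.
have {}sl := le_trans sl (ler_wpM2l st D2).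
have gap' : gain * h ^+ 2 <= 1 - modular m (w a) Nb^-1.
  rewrite (_ : gain * h ^+ 2 = cs / 64 * (h / (2 * N0 * kap)) ^+ 2 * sS).
    by rewrite lerBrDl.
  by rewrite /gain; field; rewrite !gt_eqF.
have d0 : 0 <= gain * h ^+ 2 by rewrite mulr_ge0 ?sqr_ge0// ltW.
have -> : N (a + h) + N (a - h) - 2 * N a = 2 * (Nb - N a) by exact: doubleE.
rewrite mulrAC -[N0 * gain * _]mulrA.
exact: norm_gap_ge Na0 NaNb Nb0 kc d0 gap' sl.
Qed.

Lemma disjoint_of_second_derivative_vanishes :
  is_derive (0 : R) (1 : R) N 0 -> second_derivative_vanishes_ae N -> disjoint_supports f g.
Proof.
move=> dN [E [mE E01 muE tE limE]]; apply: contrapT => nd.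
have [d [e [d0 e0 he]]] := second_difference_ge nd dN.
move/cvgr0Pnorm_lt : limE => /(_ e e0) [r /= r0 hr].
have rd : 0 < Num.min r d by rewrite lt_min r0.
have [a Ea /andP[a0]] := full_measure_near0 mE E01 muE rd.
rewrite lt_min => /andP[ar ad].
have := hr a; rewrite /ball_ /= sub0r normrN gtr0_norm// => /(_ ar).
rewrite gt_eqF// => /(_ isT Ea).
rewrite ltNge => /negP; apply; apply: le_trans (ler_norm _).
apply: (second_derivative_ge d0 (tE a Ea)) => h h0 hd.
by apply: he => //; rewrite gtr0_norm.
Qed.

End ConverseDirection.

(** * Differentiating the modular *)

(** The integrals [int w^n phi (t w)]: differentiating in [t] raises [n] by
    one and replaces [phi] by its derivative. *)
Definition weighted_modular {R : realType} (n : nat) (phi w : R -> R) (t : R) : R :=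
  \int[@lebesgue_measure R]_(x in unit_itv R) (w x ^+ n * phi (t * w x)).

Section WeightedModular.
Context {R : realType}.
Local Notation mu := (@lebesgue_measure R).
Local Notation I := (unit_itv R).
Implicit Types phi w G : R -> R.

Lemma weighted_measurable n phi w t : continuous phi -> measurable_unit w ->
  measurable_unit (fun x : R => w x ^+ n * phi (t * w x)).
Proof.
move=> cphi mw; apply: measurable_funM; first exact: measurable_funX.
apply: (measurableT_comp (f := phi)); first exact: continuous_measurable_fun.
exact: measurable_funM.
Qed.

Lemma weighted_integrable n phi w G t : continuous phi -> measurable_unit w ->
  mu.-integrable I (EFin \o G) -> (forall x, I x -> `|w x ^+ n * phi (t * w x)| <= G x) ->
  mu.-integrable I (EFin \o (fun x => w x ^+ n * phi (t * w x))).
Proof.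
by move=> cphi mw iG hG; apply: (integrable_dominated _ iG) => //; exact: weighted_measurable.
Qed.

Lemma weighted_continuous n phi w G (u v a : R) : continuous phi -> measurable_unit w ->
  mu.-integrable I (EFin \o G) -> u < a < v ->
  (forall t x, u < t < v -> I x -> `|w x ^+ n * phi (t * w x)| <= G x) ->
  {for a, continuous (weighted_modular n phi w)}.
Proof.
move=> cphi mw iG uav hG.
have ua : a \in (`]u, v[%classic : set R) by rewrite inE /= in_itv.
apply: (@continuity_under_integral _ _ _ mu (fun s x => w x ^+ n * phi (s * w x)) I
  (measurable_unit_itv R) u v _ _ G iG _ _ ua).
- move=> t; rewrite /= in_itv /= => ut; apply: (weighted_integrable cphi mw iG).
  by move=> x; exact: hG.
- apply: aeW => x Ix s _.
  have h1 := continuous_comp (@mulrr_continuous R (w x) s) (cphi (s * w x)).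
  exact: (continuous_comp h1 (@mulrl_continuous R (w x ^+ n) _)).
- by move=> t; rewrite /= in_itv /= => ut; apply: aeW => x Ix; exact: hG.
Qed.

Lemma weighted_derive n phi phi' w G (u v a : R) :
  (forall t : R, is_derive t 1 phi (phi' t)) -> measurable_unit w ->
  (forall t, u < t < v ->
     mu.-integrable I (EFin \o (fun x => w x ^+ n * phi (t * w x)))) ->
  (forall x, 0 <= G x) -> mu.-integrable I (EFin \o G) -> u < a < v ->
  (forall t x, u < t < v -> I x -> `|w x ^+ n.+1 * phi' (t * w x)| <= G x) ->
  is_derive a 1 (weighted_modular n phi w) (weighted_modular n.+1 phi' w a).
Proof.
move=> dphi mw iphi G0 iG uav hG.
pose F (t x : R) : R := w x ^+ n * phi (t * w x).
have dF (t x : R) : is_derive t 1 (F ^~ x) (w x ^+ n.+1 * phi' (t * w x)).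
  have d0 : is_derive t (1 : R) (fun t : R => t * w x) (w x).
    have -> : (fun t : R => t * w x) = w x \*: (id : R -> R).
      by apply: funext => s /=; rewrite mulrC.
    by apply: is_derive_eq; rewrite [_%:A]mulr1.
  have d1 : is_derive t 1 (phi \o (fun t => t * w x)) (phi' (t * w x) * w x).
    exact: is_derive1_comp.
  have : is_derive t 1 (w x ^+ n \*: (phi \o (fun t => t * w x)))
     (w x ^+ n.+1 * phi' (t * w x)).
    by apply: is_derive_eq; rewrite /GRing.scale /= exprS; ring.
  by [].
have ua : (`]u, v[%classic : set R) a by rewrite /= in_itv.
have dE t x : partial1of2 F t x = w x ^+ n.+1 * phi' (t * w x).
  by rewrite partial1of2E; exact: derive_val.
have iF t : (`]u, v[%classic : set R) t -> mu.-integrable I (EFin \o F t).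
  by rewrite /= in_itv /=; exact: iphi.
have dF' t x : (`]u, v[%classic : set R) t -> I x -> derivable (F ^~ x) t 1.
  by move=> _ _; case: (dF t x).
have hF t x : (`]u, v[%classic : set R) t -> I x -> `|partial1of2 F t x| <= G x.
  by rewrite /= in_itv /= dE; exact: hG.
have H1 := @derivable_under_integral _ _ _ mu F I (measurable_unit_itv R) a u v ua iF dF' G
  G0 iG hF.
have H2 := @differentiation_under_integral _ _ _ mu F I (measurable_unit_itv R) a u v ua iF dF' G
  G0 iG hF.
apply: DeriveDef; first exact: H1.
rewrite -derive1E; apply: (etrans H2); apply: eq_Rintegral => x _; exact: dE.
Qed.

End WeightedModular.

Section ModularSmooth.
Context {R : realType} {m m1 m2 : R -> R} (hm : even_C2_orlicz m m1 m2).
Local Notation mu := (@lebesgue_measure R).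
Local Notation I := (unit_itv R).
Implicit Types w : R -> R.

(** The modular of [w] is twice differentiable at [t], with the derivatives
    computed under the integral sign, and the second one is continuous at [t].
    *)
Definition modular_smooth_at w (t : R) : Prop :=
  [/\ is_derive t 1 (modular m w) (weighted_modular 1 m1 w t),
      is_derive t 1 (weighted_modular 1 m1 w) (weighted_modular 2 m2 w t) &
      {for t, continuous (weighted_modular 2 m2 w)}].

Lemma modular_weighted w : modular m w = weighted_modular 0 m w.
Proof.
by apply/funext => t; apply: eq_Rintegral => x _; rewrite expr0 mul1r.
Qed.

Lemma orl_m1_continuous : continuous m1.
Proof. by move=> t; exact: is_derive1_continuous (orl_d2 hm t). Qed.

Lemma orl_m1_odd t : m1 (- t) = - m1 t.
Proof.
have h1 : is_derive t (1 : R) (m \o -%R) (m1 (- t) * -1).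
  by have h := orl_d1 hm (- t); exact: is_derive1_comp.
have e : m \o -%R = m by apply/funext => s; exact: orl_even hm s.
rewrite e in h1; have h2 := orl_d1 hm t.
have : m1 (- t) * -1 = m1 t.
  by rewrite -(derive_val (is_derive := h1)) (derive_val (is_derive := h2)).
by rewrite mulrN1 => <-; rewrite opprK.
Qed.

Lemma orl_m1_norm_le s t : `|s| <= t -> `|m1 s| <= m1 t.
Proof.
move=> st; have [s0|s0] := leP 0 s.
  rewrite ger0_norm ?(orl_m1_ge0 hm)//; apply: (orl_m1_le hm).
  by apply: le_trans st; exact: ler_norm.
rewrite -normrN -orl_m1_odd ger0_norm ?(orl_m1_ge0 hm) ?oppr_ge0 ?(ltW s0)//.
apply: (orl_m1_le hm); apply: le_trans st; rewrite -normrN; exact: ler_norm.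
Qed.

(** A single integrable bound on both integrands near [a] suffices. *)
Lemma modular_smooth_dominated w G (u v a : R) : orlicz_class m w ->
  (forall x, 0 <= G x) -> mu.-integrable I (EFin \o G) -> u < a < v ->
  (forall t x, u < t < v -> I x -> `|w x * m1 (t * w x)| <= G x) ->
  (forall t x, u < t < v -> I x -> `|w x ^+ 2 * m2 (t * w x)| <= G x) ->
  modular_smooth_at w a.
Proof.
move=> cw G0 iG uav h1 h2; have mw := ocl_meas cw; split.
- rewrite modular_weighted; apply: (weighted_derive (orl_d1 hm) mw _ G0 iG uav).
    move=> t _; have := ocl_int cw t.
    by apply: eq_integrable => // x _; rewrite /= mul1r.
  exact: h1.
- apply: (weighted_derive (orl_d2 hm) mw _ G0 iG uav) => //.
  move=> t ut; apply: (weighted_integrable orl_m1_continuous mw iG) => x Ix.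
  by rewrite expr1; exact: h1.
- exact: (weighted_continuous (orl_cont hm) mw iG uav).
Qed.

(** For an arbitrary [w] the integrands are dominated only for parameters
    bounded away from [0]: dividing by [t] and [t^2] is what turns the growth
    conditions into bounds by the modular itself. *)
Lemma modular_smooth_pos (k c : R) w t0 : 0 < k -> 0 <= c ->
  (forall u, 0 <= u -> u ^+ 2 * m2 u <= k * m (2 * u) + c) ->
  orlicz_class m w -> 0 < t0 -> modular_smooth_at w t0.
Proof.
move=> k0 c0 hk cw t00.
pose g1 := 2 / t0 + 4 / t0 ^+ 2 * k; pose g2 := 4 / t0 ^+ 2 * c.
pose G x := g1 * m (4 * t0 * w x) + g2 * 1.
have q0 : 0 < 4 / t0 ^+ 2 by rewrite divr_gt0 ?exprn_gt0.
have p0 : 0 < 2 / t0 by rewrite divr_gt0.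
have g20 : 0 <= g2 by rewrite mulr_ge0// ltW.
have g10 : 0 <= g1 by rewrite addr_ge0 ?(ltW p0)// mulr_ge0 ?(ltW q0) ?(ltW k0).
have mG x : 0 <= m (4 * t0 * w x) by exact: (orl_ge0 hm).
have key t x : t0 / 2 < t < 2 * t0 -> 0 < t /\ m (2 * (t * w x)) <= m (4 * t0 * w x).
  move=> /andP[t1 t2]; have w0 := ocl_ge0 cw x; have tp : 0 < t by lra.
  split=> //; apply: (orl_le hm); first by rewrite !mulr_ge0// ltW.
  by rewrite mulrA ler_wpM2r//; lra.
apply: (@modular_smooth_dominated w G (t0 / 2) (2 * t0)) => //.
- by move=> x; rewrite /G mulr1 addr_ge0// mulr_ge0.
- exact: (integrable_lincomb g1 g2 (ocl_int cw (4 * t0)) (integrable_cst_unit 1)).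
- by apply/andP; split; lra.
- move=> t x ht Ix; have [tp h2] := key t x ht; have w0 := ocl_ge0 cw x.
  have tw0 : 0 <= t * w x by rewrite mulr_ge0// ltW.
  rewrite ger0_norm ?mulr_ge0 ?(orl_m1_ge0 hm)//.
  have h1 := le_trans (orl_m1_mul_le hm tw0) h2.
  have h3 : w x * m1 (t * w x) <= 2 / t0 * m (4 * t0 * w x).
    have -> : w x * m1 (t * w x) = t^-1 * (t * w x * m1 (t * w x)).
      by field; rewrite gt_eqF.
    apply: ler_pM => //; [by rewrite invr_ge0 ltW|exact: (orl_m1_mul_ge0 hm)|].
    rewrite -[leRHS]invrK lef_pV2 ?posrE ?invr_gt0// invf_div; move/andP: ht => [? _]; lra.
  have h4 : 0 <= 4 / t0 ^+ 2 * k * m (4 * t0 * w x).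
    by rewrite mulr_ge0// mulr_ge0 ?(ltW q0) ?(ltW k0).
  by rewrite /G /g1; lra.
- move=> t x ht Ix; have [tp h2] := key t x ht; have w0 := ocl_ge0 cw x.
  have tw0 : 0 <= t * w x by rewrite mulr_ge0// ltW.
  rewrite ger0_norm ?mulr_ge0 ?sqr_ge0 ?(orl_m2_ge0 hm)//.
  have h1 : (t * w x) ^+ 2 * m2 (t * w x) <= k * m (4 * t0 * w x) + c.
    by apply: le_trans (hk _ tw0) _; rewrite lerD2r ler_pM2l.
  have h3 : w x ^+ 2 * m2 (t * w x) <= 4 / t0 ^+ 2 * (k * m (4 * t0 * w x) + c).
    have -> : w x ^+ 2 * m2 (t * w x) = (t ^+ 2)^-1 * ((t * w x) ^+ 2 * m2 (t * w x)).
      by field; rewrite gt_eqF.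
    apply: ler_pM => //; first by rewrite invr_ge0 sqr_ge0.
      by rewrite mulr_ge0 ?sqr_ge0 ?(orl_m2_ge0 hm).
    have -> : 4 / t0 ^+ 2 = ((t0 / 2) ^+ 2)^-1 by field; rewrite gt_eqF.
    rewrite lef_pV2 ?posrE ?exprn_gt0// ?divr_gt0// ler_sqr ?nnegrE ?ltW// ?divr_gt0//.
    by move/andP: ht => [].
  have h4 : 0 <= 2 / t0 * m (4 * t0 * w x) by rewrite mulr_ge0// ltW.
  by rewrite /G /g1 /g2; lra.
Qed.

(** For a bounded [w] no growth condition is needed, and the parameter may be
    [0] or negative. *)
Lemma modular_smooth_bounded (C : R) w t0 :
  orlicz_class m w -> (forall x, w x <= C) -> modular_smooth_at w t0.
Proof.
move=> cw wC; pose X : R := `|t0| + 1.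
have C0 : 0 <= C := le_trans (ocl_ge0 cw 0) (wC 0).
have X0 : 0 <= X by rewrite addr_ge0.
have XC0 : 0 <= X * C by rewrite mulr_ge0.
have cm2 : {within `[- (X * C), X * C], continuous m2}.
  by apply: continuous_in_subspaceT => t _; exact: orl_cont hm t.
have XCN : - (X * C) <= X * C by rewrite (le_trans _ XC0)// oppr_le0.
have [z z0 zmax] := EVT_max XCN cm2.
have key t x : t0 - 1 < t < t0 + 1 -> `|t * w x| <= X * C.
  move=> /andP[t1 t2]; rewrite normrM (ger0_norm (ocl_ge0 cw x)).
  apply: ler_pM => //; first exact: ocl_ge0 cw x.
  have h1 := ler_norm t0; have h2 : - t0 <= `|t0| by rewrite -normrN ler_norm.
  by rewrite ler_norml /X; apply/andP; split; lra.
pose G (x : R) := C * m1 (X * C) + C ^+ 2 * m2 z.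
have G1 : 0 <= C * m1 (X * C) by rewrite mulr_ge0// (orl_m1_ge0 hm).
have G2 : 0 <= C ^+ 2 * m2 z by rewrite mulr_ge0 ?sqr_ge0 ?(orl_m2_ge0 hm).
apply: (@modular_smooth_dominated w G (t0 - 1) (t0 + 1)) => //.
- by move=> x; rewrite /G addr_ge0.
- exact: integrable_cst_unit.
- by apply/andP; split; lra.
- move=> t x ht Ix; rewrite normrM (ger0_norm (ocl_ge0 cw x)) /G.
  have : w x * `|m1 (t * w x)| <= C * m1 (X * C).
    by apply: ler_pM => //; [exact: ocl_ge0 cw x|exact: orl_m1_norm_le (key t x ht)].
  lra.
- move=> t x ht Ix; have w0 := ocl_ge0 cw x.
  rewrite ger0_norm ?mulr_ge0 ?sqr_ge0 ?(orl_m2_ge0 hm)// /G.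
  have : w x ^+ 2 * m2 (t * w x) <= C ^+ 2 * m2 z.
    apply: ler_pM => //; [exact: sqr_ge0|exact: (orl_m2_ge0 hm)| |].
      by rewrite ler_sqr ?nnegrE// (ocl_ge0 cw).
    by apply: zmax; rewrite in_itv /= -ler_norml; exact: key.
  lra.
Qed.

End ModularSmooth.

(** * An implicit function *)

Section ImplicitFunction.
Context {R : realType}.
Variables A A1 A2 B B1 B2 N : R -> R.
Hypothesis dA : forall t : R, 0 < t -> is_derive t 1 A (A1 t).
Hypothesis dA1 : forall t : R, 0 < t -> is_derive t 1 A1 (A2 t).
Hypothesis cA2 : forall t : R, 0 < t -> {for t, continuous A2}.
Hypothesis dB : forall s : R, is_derive s 1 B (B1 s).
Hypothesis dB1 : forall s : R, is_derive s 1 B1 (B2 s).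
Hypothesis cB2 : continuous B2.
Hypothesis A1_gt0 : forall t : R, 0 < t -> 0 < A1 t.
Hypothesis sB1_ge0 : forall s, 0 <= s * B1 s.
Hypothesis B1_0 : B1 0 = 0.
Hypothesis B2_0 : B2 0 = 0.
Hypothesis N_gt0 : forall a, 0 < N a.
Hypothesis cN : continuous N.
Hypothesis eqN : forall a, A (N a)^-1 + B (a / N a) = 1.

(** Denominator and value of the derivative of the function [N] defined
    implicitly by [A (1 / N a) + B (a / N a) = 1]. *)
Definition implicit_den (a : R) : R := A1 (N a)^-1 + a * B1 (a / N a).
Definition implicit_deriv (a : R) : R := B1 (a / N a) * N a / implicit_den a.

Lemma implicit_den_gt0 a : 0 < implicit_den a.
Proof.
have Na := N_gt0 a; rewrite /implicit_den ltr_pwDl ?A1_gt0 ?invr_gt0//.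
have -> : a * B1 (a / N a) = N a * (a / N a * B1 (a / N a)) by field; rewrite gt_eqF.
by rewrite mulr_ge0// ltW.
Qed.

Lemma continuous_invN (a : R) : {for a, continuous (fun z : R => (N z)^-1)}.
Proof. by apply: continuousV; [rewrite gt_eqF|exact: cN]. Qed.

Lemma continuous_divN (a : R) : {for a, continuous (fun z : R => z / N z)}.
Proof. by apply: continuousM; [exact: cvg_id|exact: continuous_invN]. Qed.

(** By Caratheodory's form of differentiability for [A] and [B], the defining
    equation reads [(N z - N a) den z = num z (z - a)] with [num] and [den]
    continuous at [a]. *)
Lemma is_derive_implicit (a : R) : is_derive a 1 N (implicit_deriv a).
Proof.
have Na := N_gt0 a; have iNa : 0 < (N a)^-1 by rewrite invr_gt0.
have /is_derive1_caratheodory[al [eA cal alE]] := dA iNa.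
have /is_derive1_caratheodory[be [eB cbe beE]] := dB (a / N a).
pose den (z : R) := al (N z)^-1 + a * be (z / N z).
pose num (z : R) := be (z / N z) * N a.
have cal' : {for a, continuous (fun z : R => al (N z)^-1)}.
  exact: (continuous_comp (continuous_invN (a:=a)) cal).
have cbe' : {for a, continuous (fun z : R => be (z / N z))}.
  exact: (continuous_comp (continuous_divN (a:=a)) cbe).
have cden : {for a, continuous den}.
  apply: continuousD => //; apply: continuousM => //; exact: cvg_cst.
have cnum : {for a, continuous num}.
  apply: continuousM => //; exact: cvg_cst.
have dena : den a = implicit_den a by rewrite /den alE beE.
have den0 : 0 < den a by rewrite dena implicit_den_gt0.
have cq : {for a, continuous (fun z : R => num z / den z)}.
  by apply: continuousM => //; apply: continuousV; rewrite ?gt_eqF.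
have key z : (N z - N a) * den z = num z * (z - a).
  have Nz := N_gt0 z.
  have h1 := eA (N z)^-1; have h2 := eB (z / N z).
  have h3 := eqN z; have h4 := eqN a.
  have : al (N z)^-1 * ((N z)^-1 - (N a)^-1) + be (z / N z) * (z / N z - a / N a) = 0.
    by rewrite -h1 -h2; lra.
  have -> : al (N z)^-1 * ((N z)^-1 - (N a)^-1) + be (z / N z) * (z / N z - a / N a) =
     (num z * (z - a) - (N z - N a) * den z) / (N z * N a).
    by rewrite /num /den; field; rewrite !gt_eqF.
  have NN : N z * N a != 0 by rewrite mulf_neq0 ?gt_eqF.
  by move/eqP; rewrite mulf_eq0 invr_eq0 (negbTE NN) orbF subr_eq0 => /eqP ->.
apply/is_derive1_caratheodory.
pose q (z : R) := if z == a then implicit_deriv a else (N z - N a) / (z - a).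
have qa : q a = num a / den a by rewrite /q eqxx dena /num beE.
exists q; split; last by rewrite /q eqxx.
- move=> z; rewrite /q; case: eqP => [->|/eqP za]; first by rewrite !subrr mulr0.
  by rewrite divfK// subr_eq0.
- suff : q z @[z --> a] --> q a by [].
  rewrite qa; apply: cvg_trans cq; apply: near_eq_cvg.
  near=> z.
  have dz : 0 < den z.
    by near: z; exact: (cvgr_gt (den a) cden _ den0).
  rewrite /q; have [->|za] := eqVneq z a; first by rewrite dena /num beE.
  have zan : z - a != 0 by rewrite subr_eq0.
  apply: (mulIf zan); rewrite divfK// mulrAC -key mulfK ?gt_eqF//.
Unshelve. all: by end_near. Qed.

(** The derivative of [implicit_deriv], by the quotient rule. *)
Definition implicit_deriv2 (a : R) : R :=
  ((B2 (a / N a) * ((N a - a * implicit_deriv a) / N a ^+ 2) * N a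
     + B1 (a / N a) * implicit_deriv a) * implicit_den a
   - B1 (a / N a) * N a *
     (A2 (N a)^-1 * (- implicit_deriv a / N a ^+ 2) + B1 (a / N a)
      + a * (B2 (a / N a) * ((N a - a * implicit_deriv a) / N a ^+ 2))))
  / implicit_den a ^+ 2.

Lemma is_derive_implicit2 (a : R) : is_derive a 1 implicit_deriv (implicit_deriv2 a).
Proof.
have Na := N_gt0 a; have iNa : 0 < (N a)^-1 by rewrite invr_gt0.
have den0 := implicit_den_gt0 a.
have dN := is_derive_implicit a.
have dV : is_derive a (1 : R) (fun z => (N z)^-1) (- implicit_deriv a / N a ^+ 2).
  have h := is_deriveV (lt0r_neq0 Na) dN.
  by apply: is_derive_eq h _; rewrite /GRing.scale /=; ring.
have dS : is_derive a (1 : R) (fun z => z / N z) ((N a - a * implicit_deriv a) / N a ^+ 2).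
  have h : is_derive a (1 : R) ((id : R -> R) * (fun z => (N z)^-1))
     (a *: (- implicit_deriv a / N a ^+ 2) + (N a)^-1 *: 1) by exact: is_deriveM.
  by apply: is_derive_eq h _; rewrite /GRing.scale /=; field; rewrite gt_eqF.
have dAV : is_derive a (1 : R) (A1 \o (fun z => (N z)^-1))
    (A2 (N a)^-1 * (- implicit_deriv a / N a ^+ 2)).
  exact: (@is_derive1_comp _ A1 (fun z => (N z)^-1) a _ _ (dA1 iNa) dV).
have dBS : is_derive a (1 : R) (B1 \o (fun z => z / N z))
    (B2 (a / N a) * ((N a - a * implicit_deriv a) / N a ^+ 2)).
  exact: (@is_derive1_comp _ B1 (fun z => z / N z) a _ _ (dB1 (a / N a)) dS).
have dD : is_derive a (1 : R) implicit_den
   (A2 (N a)^-1 * (- implicit_deriv a / N a ^+ 2) + B1 (a / N a)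
      + a * (B2 (a / N a) * ((N a - a * implicit_deriv a) / N a ^+ 2))).
  have h : is_derive a (1 : R)
     ((A1 \o (fun z => (N z)^-1)) + (id : R -> R) * (B1 \o (fun z => z / N z)))
     (A2 (N a)^-1 * (- implicit_deriv a / N a ^+ 2) +
      (a *: (B2 (a / N a) * ((N a - a * implicit_deriv a) / N a ^+ 2)) +
       B1 (a / N a) *: 1)) by apply: is_deriveD; exact: is_deriveM.
  by apply: is_derive_eq h _; rewrite /GRing.scale /=; ring.
have dDV := is_deriveV (lt0r_neq0 den0) dD.
have dnum : is_derive a (1 : R) (fun z => B1 (z / N z) * N z)
    (B1 (a / N a) *: implicit_deriv a +
     N a *: (B2 (a / N a) * ((N a - a * implicit_deriv a) / N a ^+ 2))).
  exact: (is_deriveM dBS dN).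
have h := is_deriveM dnum dDV.
apply: is_derive_eq h _; rewrite /GRing.scale /= /implicit_deriv2.
have D0 : implicit_den a != 0 by rewrite gt_eqF.
by field; rewrite D0 gt_eqF.
Qed.

Lemma implicit_deriv0 : implicit_deriv 0 = 0.
Proof. by rewrite /implicit_deriv mul0r B1_0 !mul0r. Qed.

Lemma implicit_deriv2_0 : implicit_deriv2 0 = 0.
Proof.
by rewrite /implicit_deriv2 mul0r B1_0 B2_0 !mul0r addr0 !mul0r subr0 mul0r.
Qed.

Lemma continuous_implicit_deriv2 (a : R) : {for a, continuous implicit_deriv2}.
Proof.
have Na := N_gt0 a; have iNa : 0 < (N a)^-1 by rewrite invr_gt0.
have c1 : {for a, continuous implicit_deriv}.
  exact: is_derive1_continuous (is_derive_implicit2 a).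
have cV := continuous_invN (a := a); have cS := continuous_divN (a := a).
have cB1S : {for a, continuous (fun z : R => B1 (z / N z))}.
  exact: (continuous_comp cS (is_derive1_continuous (dB1 (a / N a)))).
have cB2S : {for a, continuous (fun z : R => B2 (z / N z))}.
  exact: (continuous_comp cS (@cB2 (a / N a))).
have cA1V : {for a, continuous (fun z : R => A1 (N z)^-1)}.
  exact: (continuous_comp cV (is_derive1_continuous (dA1 iNa))).
have cA2V : {for a, continuous (fun z : R => A2 (N z)^-1)}.
  exact: (continuous_comp cV (cA2 iNa)).
have cNa := @cN a.
have cid : {for a, continuous (fun z : R => z)} by exact: cvg_id.
have cden : {for a, continuous implicit_den} by apply: continuousD => //; exact: continuousM.
have sq (F : R -> R) : {for a, continuous F} -> {for a, continuous (fun z : R => F z ^+ 2)}.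
  by move=> cF; exact: (continuousM cF cF).
have cN2 : {for a, continuous (fun z : R => (N z ^+ 2)^-1)}.
  by apply: continuousV; [rewrite expf_neq0// gt_eqF|exact: sq].
have cD2 : {for a, continuous (fun z : R => (implicit_den z ^+ 2)^-1)}.
  by apply: continuousV; [rewrite expf_neq0// gt_eqF// implicit_den_gt0|exact: sq].
have cT : {for a, continuous (fun z : R => (N z - z * implicit_deriv z) / N z ^+ 2)}.
  by apply: continuousM => //; apply: continuousB => //; exact: continuousM.
apply: continuousM => //; apply: continuousB.
- apply: continuousM => //; apply: continuousD; last exact: continuousM.
  by apply: continuousM => //; exact: continuousM.
- apply: continuousM; first exact: continuousM.
  apply: continuousD; last by apply: continuousM => //; exact: continuousM.
  apply: continuousD => //; apply: continuousM => //; apply: continuousM => //.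
  exact: continuousN.
Qed.

End ImplicitFunction.

(** * Disjoint supports *)

Section WeightedSigns.
Context {R : realType} {m m1 m2 : R -> R} (hm : even_C2_orlicz m m1 m2).
Local Notation mu := (@lebesgue_measure R).
Local Notation I := (unit_itv R).
Variable w : R -> R.
Hypothesis cw : orlicz_class m w.

Lemma weighted_modular_at0 n (phi : R -> R) : phi 0 = 0 -> weighted_modular n phi w 0 = 0.
Proof.
move=> phi0; rewrite /weighted_modular.
under eq_Rintegral do rewrite mul0r phi0 mulr0.
exact: Rintegral_cst_unit.
Qed.

(** Since [m y <= y m' y], this gives both the strict positivity of the
    derivative of the modular at positive parameters and its sign at negative
    ones. *)
Lemma modular_le_weighted1 t : modular m w t <= t * weighted_modular 1 m1 w t.
Proof.
have [->|t0] := eqVneq t 0; first by rewrite (modular0 hm) mul0r.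
have nt : 0 < `|t| by rewrite normr_gt0.
have i1 : mu.-integrable I (EFin \o (fun x => w x ^+ 1 * m1 (t * w x))).
  have := integrable_lincomb `|t|^-1 0 (ocl_int cw (2 * `|t|)) (integrable_cst_unit 0).
  move/(integrable_dominated _); apply.
    by apply: weighted_measurable (ocl_meas cw); exact: (orl_m1_continuous hm).
  move=> x Ix; rewrite mul0r addr0 expr1 normrM (ger0_norm (ocl_ge0 cw x)).
  rewrite [leRHS]mulrC ler_pdivlMr// -mulrA.
  have tw0 : 0 <= `|t| * w x by rewrite mulr_ge0// (ocl_ge0 cw).
  rewrite -mulrA; apply: le_trans (orl_m1_mul_le hm tw0).
  have -> : w x * (`|m1 (t * w x)| * `|t|) = `|t| * w x * `|m1 (t * w x)| by ring.
  rewrite ler_wpM2l//.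
  by apply: (orl_m1_norm_le hm); rewrite normrM (ger0_norm (ocl_ge0 cw x)).
have e : t * weighted_modular 1 m1 w t =
    \int[mu]_(x in I) (t * (w x ^+ 1 * m1 (t * w x)) + 0 * (w x ^+ 1 * m1 (t * w x))).
  by rewrite Rintegral_lincomb// mul0r addr0.
rewrite e; apply: le_Rintegral; [exact: measurable_unit_itv|exact: ocl_int| |].
  exact: integrable_lincomb.
move=> x Ix; rewrite mul0r addr0 expr1.
by have := orl_tangent hm (t * w x) 0; rewrite (orl_0 hm); lra.
Qed.

End WeightedSigns.

Lemma ae_lebesgue_filter (R : realType) : Filter (almost_everywhere (@lebesgue_measure R)).
Proof. exact: ae_filter_ringOfSetsType. Qed.

Section DirectDirection.
Context {R : realType} {K : scalars} (M : R -> R).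
Local Notation m := (even_ext M).
Local Notation m1 := (even_ext1 M).
Local Notation m2 := (even_ext2 M).
Context (hm : even_C2_orlicz m m1 m2) {k c k' c' : R}
  (hD2 : forall u : R, 0 <= u -> m (2 * u) <= k * m u + c)
  (k'0 : 0 < k') (c'0 : 0 <= c')
  (hD2p : forall u : R, 0 <= u -> u ^+ 2 * m2 u <= k' * m (2 * u) + c').
Local Notation mu := (@lebesgue_measure R).
Local Notation I := (unit_itv R).
Variables f g : R -> scalar_space R K.
Hypotheses (hf : in_orlicz_space M f) (hg : in_orlicz_space M g).
Hypotheses (nf : ~ null01 f) (dfg : disjoint_supports f g).
Variable C : R.
Hypothesis gC : {ae mu, forall x : R, I x -> modulus (g x) <= C}.
Local Notation N := (norm_along_line M f g).
Local Notation w := (line_modulus f g).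

(** An everywhere bounded representative of [|g|], when [g] is essentially
    bounded by [C]. *)
Definition clipped_modulus (x : R) : R := Num.min (modulus (g x)) (Num.max C 0).
Local Notation gw := clipped_modulus.
Local Notation fw := (fun x : R => modulus (f x)).

Lemma clipped_ge0 x : 0 <= gw x.
Proof. by rewrite le_min modulus_ge0 le_max lexx orbT. Qed.

Lemma clipped_class : orlicz_class m gw.
Proof.
have cg := orlicz_class_modulus hm hD2 hg.
have mgw : measurable_unit gw.
  by apply: measurable_minr; [exact: ocl_meas cg|exact: measurable_cst].
apply: (orlicz_class_add (a := 1) (b := 0) hm hD2 cg cg mgw clipped_ge0) => x.
by rewrite mul0r addr0 mul1r ge_min lexx.
Qed.

Lemma ae_disjoint : {ae mu, forall x, I x -> f x = 0 \/ g x = 0}.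
Proof.
have mA := measurableI _ _ (measurable_support hf.1) (measurable_support hg.1).
exists (support01 f `&` support01 g); split => //.
move=> x /= nx; have [Ix|nIx] := pselect (I x); last by exfalso; apply: nx.
by split; split => //; apply/eqP => e; apply: nx => _; [left|right].
Qed.

Lemma ae_clipped : {ae mu, forall x, I x -> gw x = modulus (g x)}.
Proof.
have FF := ae_lebesgue_filter R.
move: gC; apply: (@filterS _ _ FF) => x h Ix.
by apply/min_idPl; rewrite le_max h.
Qed.

(** Disjointness of the supports splits the modular into the contributions of
    [f] and of [g]. *)
Lemma modular_line_split a t :
  modular m (w a) t = modular m fw t + modular m gw (a * t).
Proof.
have cf := orlicz_class_modulus hm hD2 hf; have cl := orlicz_class_line hm hD2 hf hg a.
have e := Rintegral_lincomb 1 1 (ocl_int cf t) (ocl_int clipped_class (a * t)).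
rewrite !mul1r in e; rewrite -[RHS]e /modular /Rintegral; congr fine.
apply: ae_eq_integral; first exact: measurable_unit_itv.
- by apply/measurable_EFinP; apply: (orl_measurable hm); exact: ocl_meas cl.
- apply/measurable_EFinP; apply: measurable_funD; apply: measurable_funM => //.
    by apply: (orl_measurable hm); exact: ocl_meas cf.
  by apply: (orl_measurable hm); exact: ocl_meas clipped_class.
have FF := ae_lebesgue_filter R.
move: ae_disjoint ae_clipped; apply: (@filterS2 _ _ FF) => x h1 h2 Ix.
rewrite h2// !mul1r; congr EFin; rewrite /line_modulus.
have [->|->] := h1 Ix.
  have z0 : modulus (0 : scalar_space R K) = 0 by apply/eqP; rewrite modulus_eq0.
  rewrite add0r z0 mulr0 (orl_0 hm) add0r modulusZ.
  rewrite -(orl_norm hm) -[RHS](orl_norm hm); congr m.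
  by rewrite !normrM normr_id mulrA (mulrC `|t|).
have z0 : modulus (0 : scalar_space R K) = 0 by apply/eqP; rewrite modulus_eq0.
by rewrite scaler0 addr0 z0 mulr0 (orl_0 hm) addr0.
Qed.

Lemma modulus_f_nonnull : ~ {ae mu, forall x, I x -> fw x = 0}.
Proof.
have FF := ae_lebesgue_filter R.
move=> h; apply: nf; move: h; apply: (@filterS _ _ FF) => x h Ix.
by apply/eqP; rewrite -modulus_eq0 h.
Qed.

Lemma line_nonnull_disjoint a : line_nonnull f g a.
Proof.
have FF := ae_lebesgue_filter R.
move=> h; apply: nf; move: h ae_disjoint; apply: (@filterS2 _ _ FF) => x h1 h2 Ix.
have [//|g0] := h2 Ix.
have := h1 Ix; rewrite /line_modulus g0 scaler0 addr0 => /eqP.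
by rewrite modulus_eq0 => /eqP.
Qed.

Lemma norm_line_gt0 a : 0 < N a.
Proof. by have [] := norm_line_spec hm hD2 hf hg (@line_nonnull_disjoint a). Qed.

Lemma norm_line_continuous : continuous N.
Proof.
have [L L0 hL] := norm_line_lipschitz hm hD2 hf hg.
move=> a; apply/cvgrPdist_lt => e e0; near=> z.
apply: le_lt_trans (hL z a (@line_nonnull_disjoint z) (@line_nonnull_disjoint a)) _.
rewrite mulrC -ltr_pdivlMr//; near: z.
by apply: cvgr_dist_lt; rewrite ?divr_gt0.
Unshelve. all: by end_near. Qed.

Lemma norm_line_eq a : modular m fw (N a)^-1 + modular m gw (a / N a) = 1.
Proof.
rewrite -modular_line_split.
by have [] := norm_line_spec hm hD2 hf hg (@line_nonnull_disjoint a).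
Qed.

Lemma disjoint_second_derivative_vanishes :
  is_derive (0 : R) (1 : R) N 0 /\ second_derivative_vanishes_ae N.
Proof.
have cf := orlicz_class_modulus hm hD2 hf; have cg := clipped_class.
have sA (t : R) : 0 < t -> @modular_smooth_at R m m1 m2 fw t :=
  modular_smooth_pos hm k'0 c'0 hD2p cf.
have gwC x : gw x <= Num.max C 0 by rewrite ge_min lexx orbT.
have sB (t : R) : @modular_smooth_at R m m1 m2 gw t := modular_smooth_bounded hm t cg gwC.
pose A1 := weighted_modular 1 m1 fw; pose A2 := weighted_modular 2 m2 fw.
pose B1 := weighted_modular 1 m1 gw; pose B2 := weighted_modular 2 m2 gw.
have dA (t : R) (t0 : 0 < t) : is_derive t 1 (modular m fw) (A1 t) by case: (sA t t0).
have dA1 (t : R) (t0 : 0 < t) : is_derive t 1 A1 (A2 t) by case: (sA t t0).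
have cA2 (t : R) (t0 : 0 < t) : {for t, continuous A2} by case: (sA t t0).
have dB (t : R) : is_derive t 1 (modular m gw) (B1 t) by case: (sB t).
have dB1 (t : R) : is_derive t 1 B1 (B2 t) by case: (sB t).
have cB2 : continuous B2 by move=> t; case: (sB t).
have A1_gt0 (t : R) : 0 < t -> 0 < A1 t.
  move=> t0; have h1 := modular_gt0 hm cf t0 modulus_f_nonnull.
  have := lt_le_trans h1 (modular_le_weighted1 hm cf t).
  by rewrite pmulr_rgt0.
have sB1 (s : R) : 0 <= s * B1 s.
  exact: le_trans (modular_ge0 hm gw s) (modular_le_weighted1 hm cg s).
have B10 : B1 0 = 0 := weighted_modular_at0 _ _ (orl_m1_0 hm).
have B20 : B2 0 = 0 := weighted_modular_at0 _ _ (orl_m2_0 hm).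
have dN := is_derive_implicit dA dB A1_gt0 sB1 norm_line_gt0 norm_line_continuous norm_line_eq.
have dN2 := is_derive_implicit2 dA dA1 dB dB1 A1_gt0 sB1 norm_line_gt0
  norm_line_continuous norm_line_eq.
have cN2 := continuous_implicit_deriv2 dA dA1 cA2 dB dB1 cB2 A1_gt0 sB1 norm_line_gt0
  norm_line_continuous norm_line_eq (a := 0).
set N1 := implicit_deriv A1 B1 N in dN dN2 cN2.
set N2 := implicit_deriv2 A1 A2 B1 B2 N in dN2 cN2.
have N10 : N1 0 = 0 by apply: implicit_deriv0.
have N20 : N2 0 = 0 by apply: implicit_deriv2_0.
have e1 : N^`() = N1 by apply/funext => a; rewrite derive1E; by have [_ ->] := dN a.
have e2 : N^`(2) = N2.
  by apply/funext => a; rewrite [LHS]/= e1 derive1E; by have [_ ->] := dN2 a.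
split; first by rewrite -[X in is_derive _ _ _ X]N10; exact: dN.
exists (unit_itv R); split => //.
- exact: lebesgue_measure_unit_itv.
- move=> a _; split; last by rewrite e1; case: (dN2 a).
  by exists 1 => //= x _; case: (dN x).
- rewrite e2 -[X in _ --> X]N20; apply: cvg_trans cN2.
  apply: cvg_app; apply: cvg_trans (cvg_within _) _; exact: cvg_within.
Qed.

End DirectDirection.

Theorem proposition3p1 (R : realType) (K : scalars) (M : R -> R)
    (hM : orlicz_function M)
    (hD : Delta2plus M)
    (hcont : {within `[0, +oo[, continuous (ray_derive (ray_derive M))})
    (hM0 : ray_derive (ray_derive M) 0 = 0)
    (hMpos : forall t : R, 0 < t -> 0 < ray_derive (ray_derive M) t)
    (f g : R -> scalar_space R K)
    (hf : in_orlicz_space M f) (hg : in_orlicz_space M g) :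
  (~ null01 f -> disjoint_supports f g -> bounded01 g ->
     is_derive (0 : R) (1 : R) (norm_along_line M f g) 0 /\
     second_derivative_vanishes_ae (norm_along_line M f g)) /\
  (is_derive (0 : R) (1 : R) (norm_along_line M f g) 0 ->
   second_derivative_vanishes_ae (norm_along_line M f g) ->
     disjoint_supports f g).
Proof.
have [hder hD2 _] := hD.
have hm := even_C2_orlicz_ext hM hder hcont hM0 hMpos.
have [k [c [k0 c0 hk]]] := Delta2_affine hm hD2.
have [k' [c' [k'0 c'0 hk']]] := Delta2plus_affine hm hD.
split; last exact: (disjoint_of_second_derivative_vanishes hm k0 c0 hk hf hg).
move=> nf dfg [C gC].
exact: (disjoint_second_derivative_vanishes hm hk k'0 c'0 hk' hf hg nf dfg gC).
Qed.
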